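(* The Cesàro operator $\mathsf{C}\colon C_l([0,\infty])\to C_l([0,\infty])$ satisfies $$\sigma(\mathsf{C}; C_l([0,\infty]))=\left\{\lambda\in \mathbb{C}\colon \left|\lambda-\tfrac{1}{2}\right|= \tfrac{1}{2}\right\}$$ and $$\sigma_{pt}(\mathsf{C}; C_l([0,\infty]))=\{1\}.$$
   Context: $C_l([0,\infty])$ is the Banach space of all $\mathbb{C}$-valued continuous functions $f$ on $[0,\infty)$ for which $f(\infty):=\lim_{x\to\infty}f(x)$ exists in $\mathbb{C}$, equipped with the sup-norm. The continuous Cesàro operator is $\mathsf{C}f(x):=\frac1x\int_0^x f(t)\,dt$ for $x\in(0,\infty)$, with $\mathsf{C}f(0):=f(0)$; it maps $C_l([0,\infty])$ into itself. For a bounded linear operator $T$ on a Banach space $X$, $\sigma(T;X)$ is the set of $\lambda\in\mathbb{C}$ such that $\lambda I-T$ is not invertible in the bounded linear operators on $X$, and $\sigma_{pt}(T;X)$ is the set of $\lambda\in\mathbb{C}$ such that $\lambda I-T$ is not injective. *)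

(* Defs.v *)
From Stdlib Require Import Reals Lra.
From Stdlib Require Import FunctionalExtensionality PropExtensionality.
From Stdlib Require Import ProofIrrelevance ClassicalEpsilon.
From Coquelicot Require Import Coquelicot.
Open Scope R_scope.

(* Coquelicot's [is_linear] includes boundedness: [norm (T x) <= M * norm x]. *)
Record bounded_operator (X : NormedModule C_AbsRing) := {
  op_fun :> X -> X;
  op_linear : is_linear op_fun
}.

Definition invertible_op {X : NormedModule C_AbsRing} (A : X -> X) : Prop :=
  exists S : bounded_operator X,
    (forall x, S (A x) = x) /\ (forall x, A (S x) = x).

Definition scalar_minus {X : NormedModule C_AbsRing}
    (lambda : C) (T : bounded_operator X) : X -> X :=
  fun x => minus (scal lambda x) (T x).

Definition spectrum {X : CompleteNormedModule C_AbsRing}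
    (T : bounded_operator X) : C -> Prop :=
  fun lambda => ~ invertible_op (scalar_minus lambda T).

Definition point_spectrum {X : CompleteNormedModule C_AbsRing}
    (T : bounded_operator X) : C -> Prop :=
  fun lambda =>
    ~ (forall x y, scalar_minus lambda T x = scalar_minus lambda T y -> x = y).

(* Functions on [0, oo) are functions on [nonnegreal].  Coquelicot's limits and
   integrals are stated for functions on [R], so they are applied to the
   extension that is constant on (-oo, 0]; only its values on [0, oo) matter. *)
Definition extend (f : nonnegreal -> C) (t : R) : C :=
  f (mknonnegreal (Rmax 0 t) (Rmax_l 0 t)).

Record C_l := {
  C_l_fun :> nonnegreal -> C;
  C_l_continuous : continuous_on (fun t : R => 0 <= t) (extend C_l_fun);
  C_l_limit : exists l : C,
    filterlim (extend C_l_fun) (Rbar_locally p_infty) (locally l)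
}.

(* [Lub_Rbar] is a real number here: [sup_norm_ge] and [sup_norm_le] show that
   on [C_l] this is the supremum. *)
Definition sup_norm (f : nonnegreal -> C) : R :=
  real (Lub_Rbar (fun r : R => exists x : nonnegreal, r = Cmod (f x))).

Lemma nonnegreal_eq (x y : nonnegreal) : nonneg x = nonneg y -> x = y.
Proof.
destruct x as [x hx], y as [y hy]; simpl; intros ->.
now rewrite (proof_irrelevance _ hx hy).
Qed.

Lemma extend_nonneg (f : nonnegreal -> C) (x : nonnegreal) : extend f x = f x.
Proof.
unfold extend; f_equal; apply nonnegreal_eq; simpl.
apply Rmax_right, cond_nonneg.
Qed.

Lemma C_l_eq (f g : C_l) : (forall x, f x = g x) -> f = g.
Proof.
destruct f as [f cf lf], g as [g cg lg]; simpl; intros H.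
assert (E : f = g) by (apply functional_extensionality; exact H).
subst g; now rewrite (proof_irrelevance _ cf cg), (proof_irrelevance _ lf lg).
Qed.

Lemma filterlim_C (T : Type) (F : (T -> Prop) -> Prop) (FF : Filter F)
    (f : T -> C) (y : C) :
  filterlim f F (locally y) <->
  (forall eps : posreal, F (fun x => Cmod (f x - y) < eps)).
Proof. exact (@filterlim_locally_ball_norm C_AbsRing T C_NormedModule F FF f y). Qed.

Lemma extend_continuous (f : C_l) (t : R) : continuous (extend f) t.
Proof.
apply (filterlim_ext (fun s => extend f (Rmax 0 s))).
  intros s; unfold extend; f_equal; apply nonnegreal_eq; simpl.
  apply Rmax_right, Rmax_l.
replace (extend f t) with (extend f (Rmax 0 t)).
  2: unfold extend; f_equal; apply nonnegreal_eq; simpl;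
     apply Rmax_right, Rmax_l.
eapply filterlim_comp; [| apply (C_l_continuous f); apply Rmax_l].
intros P [d Hd]; exists d; intros y Hy; apply Hd; [| apply Rmax_l].
revert Hy; unfold ball; simpl; unfold AbsRing_ball, abs, minus, plus, opp; simpl.
unfold Rmax; repeat destruct Rle_dec; intros H;
  apply Rabs_def1; apply Rabs_def2 in H; lra.
Qed.

Lemma extend_bounded (f : C_l) : exists M, 0 <= M /\ forall t, Cmod (extend f t) <= M.
Proof.
destruct (C_l_limit f) as [l Hl].
rewrite filterlim_C in Hl by apply Rbar_locally_filter.
destruct (Hl (mkposreal 1 Rlt_0_1)) as [A HA]; simpl in HA.
destruct (@bounded_continuity C_AbsRing C_NormedModule (extend f) 0 (Rmax 0 A))
  as [M HM].
  intros x _; apply extend_continuous.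
assert (H0 : 0 <= M).
{ apply Rle_trans with (2 := Rlt_le _ _ (HM 0 (conj (Rle_refl 0) (Rmax_l 0 A)))).
  apply Cmod_ge_0. }
exists (M + (Cmod l + 1)); split; [pose proof (Cmod_ge_0 l); lra |].
assert (P : forall t, 0 <= t -> Cmod (extend f t) <= M + (Cmod l + 1)).
{ intros t Ht; destruct (Rle_lt_dec t A) as [Hle | Hlt].
  - assert (Cmod (extend f t) < M).
      apply (HM t); split; [exact Ht | apply Rle_trans with (1 := Hle), Rmax_r].
    pose proof (Cmod_ge_0 l); lra.
  - specialize (HA t Hlt).
    replace (extend f t) with ((extend f t - l) + l)%C by ring.
    pose proof (Cmod_triangle (extend f t - l) l); lra. }
intros t.
replace (extend f t) with (extend f (Rmax 0 t)).
  apply P, Rmax_l.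
unfold extend; f_equal; apply nonnegreal_eq; simpl; apply Rmax_right, Rmax_l.
Qed.

Lemma sup_norm_ge (f : C_l) (x : nonnegreal) : Cmod (f x) <= sup_norm f.
Proof.
destruct (extend_bounded f) as [M [H0 HM]]; unfold sup_norm.
destruct (Lub_Rbar_correct (fun r => exists x : nonnegreal, r = Cmod (f x)))
  as [ub lub].
set (L := Lub_Rbar _) in *.
assert (H1 : Rbar_le (Cmod (f x)) L) by (apply ub; eauto).
assert (H2 : Rbar_le L M).
{ apply lub; intros r [y ->]; rewrite <- extend_nonneg; apply HM. }
destruct L; simpl in *; tauto || assumption.
Qed.

Lemma sup_norm_le (f : C_l) (M : R) :
  (forall x, Cmod (f x) <= M) -> sup_norm f <= M.
Proof.
intros HM; unfold sup_norm.
destruct (Lub_Rbar_correct (fun r => exists x : nonnegreal, r = Cmod (f x)))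
  as [ub lub].
set (L := Lub_Rbar _) in *.
assert (H2 : Rbar_le L M) by (apply lub; intros r [y ->]; apply HM).
assert (H1 : Rbar_le (Cmod (f (mknonnegreal 0 (Rle_refl 0)))) L) by (apply ub; eauto).
destruct L; simpl in *; tauto || assumption.
Qed.

Lemma C_l_zero_continuous :
  continuous_on (fun t : R => 0 <= t) (extend (fun _ => RtoC 0)).
Proof.
intros t _.
exact (@filterlim_const R C_UniformSpace (within (fun t : R => 0 <= t) (locally t)) _ (RtoC 0)).
Qed.

Lemma C_l_zero_limit :
  exists l : C, filterlim (extend (fun _ => RtoC 0)) (Rbar_locally p_infty) (locally l).
Proof.
exists (RtoC 0).
exact (@filterlim_const R C_UniformSpace (Rbar_locally p_infty) _ (RtoC 0)).
Qed.

Definition C_l_zero : C_l :=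
  Build_C_l (fun _ => RtoC 0) C_l_zero_continuous C_l_zero_limit.

Lemma C_l_plus_continuous (f g : C_l) :
  continuous_on (fun t : R => 0 <= t) (extend (fun x => f x + g x)%C).
Proof.
intros t Ht.
refine (filterlim_comp_2 _ _ _ (C_l_continuous f t Ht) (C_l_continuous g t Ht) _).
exact (@filterlim_plus C_AbsRing C_NormedModule _ _).
Qed.

Lemma C_l_plus_limit (f g : C_l) :
  exists l : C,
    filterlim (extend (fun x => f x + g x)%C) (Rbar_locally p_infty) (locally l).
Proof.
destruct (C_l_limit f) as [l Hl], (C_l_limit g) as [m Hm].
exists (l + m)%C; refine (filterlim_comp_2 _ _ _ Hl Hm _).
exact (@filterlim_plus C_AbsRing C_NormedModule _ _).
Qed.

Definition C_l_plus (f g : C_l) : C_l :=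
  Build_C_l (fun x => f x + g x)%C (C_l_plus_continuous f g) (C_l_plus_limit f g).

Lemma C_l_scal_continuous (c : C) (f : C_l) :
  continuous_on (fun t : R => 0 <= t) (extend (fun x => c * f x)%C).
Proof.
intros t Ht.
refine (filterlim_comp _ _ _ _ _ _ _ _ (C_l_continuous f t Ht) _).
exact (@filterlim_scal_r C_AbsRing C_NormedModule c _).
Qed.

Lemma C_l_scal_limit (c : C) (f : C_l) :
  exists l : C,
    filterlim (extend (fun x => c * f x)%C) (Rbar_locally p_infty) (locally l).
Proof.
destruct (C_l_limit f) as [l Hl].
exists (c * l)%C; refine (filterlim_comp _ _ _ _ _ _ _ _ Hl _).
exact (@filterlim_scal_r C_AbsRing C_NormedModule c _).
Qed.

Definition C_l_scal (c : C) (f : C_l) : C_l :=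
  Build_C_l (fun x => c * f x)%C (C_l_scal_continuous c f) (C_l_scal_limit c f).

Definition C_l_opp (f : C_l) : C_l := C_l_scal (- (1))%C f.

Definition C_l_AbelianMonoid_mixin : AbelianMonoid.mixin_of C_l.
Proof.
apply (AbelianMonoid.Mixin C_l C_l_plus C_l_zero); intros;
  apply C_l_eq; intros; simpl; ring.
Defined.

Canonical C_l_AbelianMonoid := AbelianMonoid.Pack C_l C_l_AbelianMonoid_mixin C_l.

Definition C_l_AbelianGroup_mixin : AbelianGroup.mixin_of C_l_AbelianMonoid.
Proof.
apply (AbelianGroup.Mixin C_l_AbelianMonoid C_l_opp); intros;
  apply C_l_eq; intros; simpl; ring.
Defined.

Canonical C_l_AbelianGroup :=
  AbelianGroup.Pack C_l (AbelianGroup.Class _ _ C_l_AbelianGroup_mixin) C_l.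

Definition C_l_ModuleSpace_mixin : ModuleSpace.mixin_of C_Ring C_l_AbelianGroup.
Proof.
apply (ModuleSpace.Mixin C_Ring C_l_AbelianGroup C_l_scal); intros;
  apply C_l_eq; intros; simpl; unfold mult, plus, one; simpl; ring.
Defined.

Canonical C_l_ModuleSpace :=
  ModuleSpace.Pack C_Ring C_l (ModuleSpace.Class _ _ _ C_l_ModuleSpace_mixin) C_l.

Definition C_l_ball (f : C_l) (eps : R) (g : C_l) : Prop :=
  sup_norm (minus g f) < eps.

Lemma C_l_minusE (f g : C_l) (x : nonnegreal) : (minus f g : C_l) x = (f x - g x)%C.
Proof. unfold minus, plus, opp; simpl; ring. Qed.

Lemma sup_norm_plus (f g : C_l) : sup_norm (C_l_plus f g) <= sup_norm f + sup_norm g.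
Proof.
apply sup_norm_le; intros x; simpl.
pose proof (Cmod_triangle (f x) (g x)).
pose proof (sup_norm_ge f x); pose proof (sup_norm_ge g x); lra.
Qed.

Lemma sup_norm_scal (c : C) (f : C_l) : sup_norm (C_l_scal c f) <= Cmod c * sup_norm f.
Proof.
apply sup_norm_le; intros x; simpl; rewrite Cmod_mult.
apply Rmult_le_compat_l; [apply Cmod_ge_0 | apply sup_norm_ge].
Qed.

Lemma sup_norm_eq_0 (f : C_l) : sup_norm f = 0 -> f = zero.
Proof.
intros H; apply C_l_eq; intros x; simpl; apply Cmod_eq_0.
pose proof (sup_norm_ge f x); pose proof (Cmod_ge_0 (f x)); lra.
Qed.

Definition C_l_UniformSpace_mixin : UniformSpace.mixin_of C_l.
Proof.
apply (UniformSpace.Mixin C_l C_l_zero C_l_ball).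
- intros f eps; apply Rle_lt_trans with 0; [| apply cond_pos].
  apply sup_norm_le; intros x; rewrite C_l_minusE.
  replace (f x - f x)%C with (RtoC 0) by ring; rewrite Cmod_0; lra.
- intros f g e H; apply Rle_lt_trans with (2 := H).
  apply sup_norm_le; intros x; rewrite C_l_minusE.
  replace (f x - g x)%C with (- (g x - f x))%C by ring.
  rewrite Cmod_opp, <- C_l_minusE; apply sup_norm_ge.
- intros f g h e1 e2 H1 H2; unfold C_l_ball in *.
  apply Rle_lt_trans with (sup_norm (minus g f) + sup_norm (minus h g)); [| lra].
  replace (minus h f) with (C_l_plus (minus g f) (minus h g)).
    apply sup_norm_plus.
  apply C_l_eq; intros x; simpl; ring.
Defined.

Canonical C_l_UniformSpace := UniformSpace.Pack C_l C_l_UniformSpace_mixin C_l.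

Canonical C_l_NormedModuleAux :=
  NormedModuleAux.Pack C_AbsRing C_l
    (NormedModuleAux.Class C_AbsRing C_l
       (ModuleSpace.class C_Ring C_l_ModuleSpace) C_l_UniformSpace_mixin) C_l.

Definition C_l_NormedModule_mixin : NormedModule.mixin_of C_AbsRing C_l_NormedModuleAux.
Proof.
apply (NormedModule.Mixin C_AbsRing C_l_NormedModuleAux (fun f : C_l => sup_norm f) 1).
- exact sup_norm_plus.
- exact sup_norm_scal.
- intros f g eps H; exact H.
- intros f g eps H; rewrite Rmult_1_l; exact H.
- exact sup_norm_eq_0.
Defined.

Canonical C_l_NormedModule :=
  NormedModule.Pack C_AbsRing C_l
    (NormedModule.Class C_AbsRing C_l _ C_l_NormedModule_mixin) C_l.

Definition C_l_complete_lim (F : (C_l -> Prop) -> Prop) : C_l :=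
  epsilon (inhabits C_l_zero) (fun f : C_l => forall eps : posreal, F (C_l_ball f eps)).

Lemma C_l_ball_le (f g : C_l) (eps : R) :
  C_l_ball f eps g -> forall x, Cmod (g x - f x) < eps.
Proof.
intros H x; apply Rle_lt_trans with (2 := H); rewrite <- C_l_minusE.
apply sup_norm_ge.
Qed.

Lemma uniform_limit_C_l (g : nonnegreal -> C) :
  (forall eps : posreal, exists f : C_l, forall x, Cmod (f x - g x) <= eps) ->
  exists h : C_l, forall x, h x = g x.
Proof.
intros H.
assert (He : forall eps : posreal, exists f : C_l,
          forall t, Cmod (extend f t - extend g t) <= eps).
{ intros eps; destruct (H eps) as [f Hf]; exists f; intros t; apply Hf. }
assert (Cg : continuous_on (fun t : R => 0 <= t) (extend g)).
{ intros t Ht.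
  apply (filterlim_C _ (within (fun t : R => 0 <= t) (locally t)) _); intros eps.
  assert (H4 : 0 < eps / 4) by (pose proof (cond_pos eps); lra).
  destruct (He (mkposreal _ H4)) as [f Hf]; simpl in Hf.
  pose proof (C_l_continuous f t Ht) as Cf.
  rewrite filterlim_C in Cf by apply within_filter, locally_filter.
  generalize (Cf (mkposreal _ H4)); apply filter_imp; simpl; intros s Hs.
  replace (extend g s - extend g t)%C with
    (- (extend f s - extend g s) + (extend f s - extend f t)
       + (extend f t - extend g t))%C by ring.
  eapply Rle_lt_trans; [apply Cmod_triangle |].
  pose proof (Cmod_triangle (- (extend f s - extend g s)) (extend f s - extend f t)).
  rewrite Cmod_opp in *; pose proof (Hf s); pose proof (Hf t); lra. }
assert (Lg : exists l : C, filterlim (extend g) (Rbar_locally p_infty) (locally l)).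
{ apply (@filterlim_locally_cauchy R C_R_CompleteNormedModule _
           (Rbar_locally_filter p_infty)).
  intros eps.
  assert (H4 : 0 < eps / 4) by (pose proof (cond_pos eps); lra).
  destruct (He (mkposreal _ H4)) as [f Hf]; simpl in Hf.
  destruct (C_l_limit f) as [l Hl].
  rewrite filterlim_C in Hl by apply Rbar_locally_filter.
  eexists; split; [apply (Hl (mkposreal _ H4)) |]; simpl; intros u v Hu Hv.
  apply (@norm_compat1 C_AbsRing C_NormedModule).
  change (Cmod (extend g v - extend g u) < eps).
  replace (extend g v - extend g u)%C with
    (- (extend f v - extend g v) + (extend f v - l)
       + (- (extend f u - l) + (extend f u - extend g u)))%C by ring.
  eapply Rle_lt_trans; [apply Cmod_triangle |].
  pose proof (Cmod_triangle (- (extend f v - extend g v)) (extend f v - l)).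
  pose proof (Cmod_triangle (- (extend f u - l)) (extend f u - extend g u)).
  rewrite Cmod_opp in *; pose proof (Hf u); pose proof (Hf v); lra. }
exists (Build_C_l g Cg Lg); reflexivity.
Qed.

Lemma C_l_complete (F : (C_l -> Prop) -> Prop) :
  ProperFilter F ->
  (forall eps : posreal, exists f : C_l, F (C_l_ball f eps)) ->
  exists h : C_l, forall eps : posreal, F (C_l_ball h eps).
Proof.
intros FF Hc.
assert (Hp : forall x : nonnegreal, exists y : C,
          filterlim (fun f : C_l => f x) F (locally y)).
{ intros x; apply (@filterlim_locally_cauchy C_l C_R_CompleteNormedModule F FF).
  intros eps.
  assert (H2 : 0 < eps / 2) by (pose proof (cond_pos eps); lra).
  destruct (Hc (mkposreal _ H2)) as [f Hf]; simpl in Hf.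
  eexists; split; [exact Hf |]; intros u v Hu Hv.
  apply (@norm_compat1 C_AbsRing C_NormedModule).
  change (Cmod (v x - u x) < eps).
  replace (v x - u x)%C with ((v x - f x) + (- (u x - f x)))%C by ring.
  eapply Rle_lt_trans; [apply Cmod_triangle |]; rewrite Cmod_opp.
  pose proof (C_l_ball_le _ _ _ Hu x); pose proof (C_l_ball_le _ _ _ Hv x); lra. }
pose (g := fun x => proj1_sig (constructive_indefinite_description _ (Hp x))).
assert (Hg : forall x, filterlim (fun f : C_l => f x) F (locally (g x))).
{ intros x; unfold g; now destruct constructive_indefinite_description. }
clearbody g.
assert (Hu : forall (f : C_l) (e : R), F (C_l_ball f e) ->
          forall x, Cmod (f x - g x) <= e).
{ intros f e Hf x; apply Rnot_lt_le; intros Hlt.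
  specialize (Hg x).
  rewrite filterlim_C in Hg by apply filter_filter.
  assert (Hd : 0 < Cmod (f x - g x) - e) by lra.
  destruct (filter_ex _ (filter_and _ _ Hf (Hg (mkposreal _ Hd)))) as [k [Hk1 Hk2]].
  simpl in Hk2; pose proof (C_l_ball_le _ _ _ Hk1 x) as Hk3.
  pose proof (Cmod_triangle (- (k x - f x)) (k x - g x)) as Ht.
  replace (- (k x - f x) + (k x - g x))%C with (f x - g x)%C in Ht by ring.
  rewrite Cmod_opp in Ht; lra. }
destruct (uniform_limit_C_l g) as [h Hh].
  intros eps; destruct (Hc eps) as [f Hf]; exists f; now apply Hu.
exists h; intros eps.
assert (H3 : 0 < eps / 3) by (pose proof (cond_pos eps); lra).
destruct (Hc (mkposreal _ H3)) as [f Hf].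
generalize Hf; apply filter_imp; simpl; intros k Hk.
apply Rle_lt_trans with (eps / 3 + eps / 3); [| pose proof (cond_pos eps); lra].
apply sup_norm_le; intros x; rewrite C_l_minusE, Hh.
replace (k x - g x)%C with ((k x - f x) + (f x - g x))%C by ring.
eapply Rle_trans; [apply Cmod_triangle |].
pose proof (C_l_ball_le _ _ _ Hk x); pose proof (Hu f _ Hf x) as Hx; simpl in Hx; lra.
Qed.

Definition C_l_CompleteSpace_mixin : CompleteSpace.mixin_of C_l_UniformSpace.
Proof.
apply (CompleteSpace.Mixin C_l_UniformSpace C_l_complete_lim).
- intros F FF Hc.
  exact (epsilon_spec (inhabits C_l_zero)
           (fun f : C_l => forall eps : posreal, F (C_l_ball f eps))
           (C_l_complete F FF Hc)).
- intros F1 F2 H12 H21.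
  assert (E : F1 = F2).
  { apply functional_extensionality; intros P.
    apply propositional_extensionality; split; [apply H21 | apply H12]. }
  subst F2; intros eps; apply ball_center.
Defined.

Canonical C_l_CompleteNormedModule :=
  CompleteNormedModule.Pack C_AbsRing C_l
    (CompleteNormedModule.Class C_AbsRing C_l
       (NormedModule.class C_AbsRing C_l_NormedModule) C_l_CompleteSpace_mixin) C_l.

(* [C_R_CompleteNormedModule] is [C] as a complete normed space over [R], the
   structure needed for the integral of a [C]-valued function on [R]. *)
Definition cesaro_fun (f : nonnegreal -> C) (x : nonnegreal) : C :=
  if Req_EM_T x 0 then f (mknonnegreal 0 (Rle_refl 0))
  else (RtoC (/ x) * RInt (V := C_R_CompleteNormedModule) (extend f) 0 x)%C.

Lemma extend_ex_RInt (f : C_l) (a b : R) :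
  ex_RInt (V := C_R_CompleteNormedModule) (extend f) a b.
Proof. apply ex_RInt_continuous; intros t _; apply extend_continuous. Qed.

Lemma extend_is_RInt (f : C_l) (a b : R) :
  is_RInt (V := C_R_NormedModule) (extend f) a b
    (RInt (V := C_R_CompleteNormedModule) (extend f) a b).
Proof. exact (RInt_correct (V := C_R_CompleteNormedModule) _ _ _ (extend_ex_RInt f a b)). Qed.

Lemma RInt_extend_minus_le (f : C_l) (c : C) (M a b : R) : a <= b ->
  (forall t, a <= t <= b -> Cmod (extend f t - c) <= M) ->
  Cmod (RInt (V := C_R_CompleteNormedModule) (extend f) a b - RtoC (b - a) * c)
    <= (b - a) * M.
Proof.
intros Hab HM.
pose proof (is_RInt_minus _ _ _ _ _ _ (extend_is_RInt f a b)
              (is_RInt_const (V := C_R_NormedModule) a b c)) as HI.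
rewrite Cmod_norm.
replace (RInt (V := C_R_CompleteNormedModule) (extend f) a b - RtoC (b - a) * c)%C
  with (minus (RInt (V := C_R_CompleteNormedModule) (extend f) a b)
          (scal (V := C_R_NormedModule) (b - a) c)).
2:{ rewrite scal_R_Cmult; reflexivity. }
apply (norm_RInt_le_const _ _ _ _ _ Hab) with (2 := HI).
intros t Ht; specialize (HM t Ht); rewrite Cmod_norm in HM; exact HM.
Qed.

Lemma is_RInt_Cscal (c : C) (f : R -> C) (a b : R) (I : C) :
  is_RInt (V := C_R_NormedModule) f a b I ->
  is_RInt (V := C_R_NormedModule) (fun t => c * f t)%C a b (c * I)%C.
Proof.
intros HI.
pose proof (is_RInt_fct_extend_fst f a b I HI) as H1.
pose proof (is_RInt_fct_extend_snd f a b I HI) as H2.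
apply (is_RInt_fct_extend_pair (fun t => c * f t)%C a b).
- exact (is_RInt_minus _ _ _ _ _ _ (is_RInt_scal _ _ _ (fst c) _ H1)
           (is_RInt_scal _ _ _ (snd c) _ H2)).
- exact (is_RInt_plus _ _ _ _ _ _ (is_RInt_scal _ _ _ (fst c) _ H2)
           (is_RInt_scal _ _ _ (snd c) _ H1)).
Qed.

Lemma cesaro_fun_pos (f : nonnegreal -> C) (t : R) : 0 < t ->
  extend (cesaro_fun f) t =
  (RtoC (/ t) * RInt (V := C_R_CompleteNormedModule) (extend f) 0 t)%C.
Proof.
intros Ht; unfold extend at 1, cesaro_fun; simpl.
rewrite Rmax_right by lra; destruct Req_EM_T; [lra | reflexivity].
Qed.

Lemma cesaro_fun_minus_le (f : C_l) (c : C) (M t : R) : 0 <= t ->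
  (forall s, 0 <= s <= t -> Cmod (extend f s - c) <= M) ->
  Cmod (extend (cesaro_fun f) t - c) <= M.
Proof.
intros [Ht | <-] HM.
- rewrite cesaro_fun_pos by exact Ht.
  assert (Ht0 : RtoC t <> 0) by (intros E; apply RtoC_inj in E; lra).
  replace (RtoC (/ t) * RInt (V := C_R_CompleteNormedModule) (extend f) 0 t - c)%C
    with (RtoC (/ t) *
          (RInt (V := C_R_CompleteNormedModule) (extend f) 0 t - RtoC (t - 0) * c))%C.
  2:{ rewrite Rminus_0_r, RtoC_inv by lra; field; exact Ht0. }
  rewrite Cmod_mult, Cmod_R, Rabs_right
    by (apply Rle_ge, Rlt_le, Rinv_0_lt_compat, Ht).
  apply Rmult_le_reg_l with (1 := Ht); rewrite <- Rmult_assoc, Rinv_r, Rmult_1_l by lra.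
  pose proof (RInt_extend_minus_le f c M 0 t (Rlt_le _ _ Ht) HM); lra.
- replace (extend (cesaro_fun f) 0) with (extend f 0).
    apply HM; lra.
  unfold extend, cesaro_fun; simpl; destruct Req_EM_T as [_ | E].
    f_equal; apply nonnegreal_eq; simpl; apply Rmax_right, Rle_refl.
  exfalso; apply E, Rmax_right, Rle_refl.
Qed.

Lemma cesaro_continuous (f : C_l) :
  continuous_on (fun t : R => 0 <= t) (extend (cesaro_fun f)).
Proof.
intros t [Ht | <-].
- eapply filterlim_filter_le_1; [apply filter_le_within |].
  apply (filterlim_ext_loc (fun s => RtoC (/ s) *
           RInt (V := C_R_CompleteNormedModule) (extend f) 0 s)%C).
    exists (mkposreal t Ht); intros s Hs; symmetry; apply cesaro_fun_pos.
    revert Hs; unfold ball; simpl; unfold AbsRing_ball, abs, minus, plus, opp; simpl.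
    intros Hs; apply Rabs_def2 in Hs; lra.
  rewrite cesaro_fun_pos by exact Ht.
  apply (filterlim_ext (fun s => scal (V := C_R_NormedModule) (/ s)
           (RInt (V := C_R_CompleteNormedModule) (extend f) 0 s))).
    intros s; apply scal_R_Cmult.
  rewrite <- scal_R_Cmult.
  refine (filterlim_comp_2 (G := locally (/ t)) _ _ _ _ _
            (filterlim_scal (V := C_R_NormedModule) (/ t) _)).
  + apply (continuous_Rinv t); lra.
  + apply (continuous_RInt_1 (V := C_R_NormedModule) (extend f) 0 t).
    apply filter_forall; intros s; apply extend_is_RInt.
- rewrite filterlim_C by apply within_filter, locally_filter; intros eps.
  assert (H2 : 0 < eps / 2) by (pose proof (cond_pos eps); lra).
  pose proof (extend_continuous f 0) as Cf; unfold continuous in Cf.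
  rewrite filterlim_C in Cf by apply locally_filter.
  destruct (Cf (mkposreal _ H2)) as [d Hd]; simpl in Hd.
  exists d; intros s Hs Hs0.
  replace (extend (cesaro_fun f) 0) with (extend f 0).
  2:{ unfold extend, cesaro_fun; simpl; destruct Req_EM_T as [_ | E].
        f_equal; apply nonnegreal_eq; simpl; apply Rmax_right, Rle_refl.
      exfalso; apply E, Rmax_right, Rle_refl. }
  apply Rle_lt_trans with (eps / 2); [| lra].
  apply cesaro_fun_minus_le; [exact Hs0 |]; intros u Hu.
  apply Rlt_le, Hd.
  revert Hs; unfold ball; simpl; unfold AbsRing_ball, abs, minus, plus, opp; simpl.
  intros Hs; apply Rabs_def2 in Hs; apply Rabs_def1; lra.
Qed.

Lemma cesaro_limit (f : C_l) :
  exists l : C, filterlim (extend (cesaro_fun f)) (Rbar_locally p_infty) (locally l).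
Proof.
destruct (C_l_limit f) as [l Hl]; exists l.
rewrite filterlim_C in Hl by apply Rbar_locally_filter.
rewrite filterlim_C by apply Rbar_locally_filter; intros eps.
assert (H2 : 0 < eps / 2) by (pose proof (cond_pos eps); lra).
destruct (Hl (mkposreal _ H2)) as [A0 HA0]; simpl in HA0.
destruct (extend_bounded f) as [M0 [HM0 HM]].
set (M := M0 + Cmod l).
assert (HMl : forall t, Cmod (extend f t - l) <= M).
{ intros t; pose proof (Cmod_triangle (extend f t) (- l)); rewrite Cmod_opp in H.
  specialize (HM t); unfold M, Cminus; lra. }
assert (HMp : 0 <= M) by (pose proof (Cmod_ge_0 l); unfold M; lra).
set (A := Rmax A0 0 + 1).
assert (HA : 0 < A /\ A0 < A).
{ unfold A; pose proof (Rmax_l A0 0); pose proof (Rmax_r A0 0); lra. }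
exists (A + 2 * (A * M) / eps); intros t Ht.
assert (Hq : 0 <= 2 * (A * M) / eps).
{ apply Rmult_le_pos; [| apply Rlt_le, Rinv_0_lt_compat, cond_pos].
  apply Rmult_le_pos; [lra | apply Rmult_le_pos; lra]. }
assert (HAt : A < t) by lra.
assert (Hsmall : A * M < (t - A) * (eps / 2)).
{ replace (A * M) with ((2 * (A * M) / eps) * (eps / 2))
    by (field; apply Rgt_not_eq, cond_pos).
  apply Rmult_lt_compat_r; lra. }
rewrite cesaro_fun_pos by lra.
assert (Ht0 : RtoC t <> 0) by (intros E; apply RtoC_inj in E; lra).
pose proof (RInt_extend_minus_le f l M 0 A (Rlt_le _ _ (proj1 HA))
              (fun s _ => HMl s)) as I1.
assert (I2 := RInt_extend_minus_le f l (eps / 2) A t (Rlt_le _ _ HAt)).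
lapply I2; [clear I2; intros I2 | intros s Hs; apply Rlt_le, HA0; lra].
pose proof (RInt_Chasles (V := C_R_CompleteNormedModule) (extend f) 0 A t
              (extend_ex_RInt f 0 A) (extend_ex_RInt f A t)) as E.
change plus with Cplus in E; rewrite <- E.
set (U := RInt (V := C_R_CompleteNormedModule) (extend f) 0 A) in *.
set (V := RInt (V := C_R_CompleteNormedModule) (extend f) A t) in *.
replace (RtoC (/ t) * (U + V) - l)%C with
  (RtoC (/ t) * ((U - RtoC (A - 0) * l) + (V - RtoC (t - A) * l)))%C.
2:{ rewrite RtoC_inv, !RtoC_minus by lra; field; exact Ht0. }
rewrite Cmod_mult, Cmod_R, Rabs_right
  by (apply Rle_ge, Rlt_le, Rinv_0_lt_compat; lra).
apply Rmult_lt_reg_l with t; [lra |].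
rewrite <- Rmult_assoc, Rinv_r, Rmult_1_l by lra.
eapply Rle_lt_trans; [apply Cmod_triangle |].
assert (0 < A * eps) by (apply Rmult_lt_0_compat; [lra | apply cond_pos]).
lra.
Qed.

Definition cesaro_map (f : C_l) : C_l :=
  Build_C_l (cesaro_fun f) (cesaro_continuous f) (cesaro_limit f).

Lemma cesaro_map_linear : is_linear cesaro_map.
Proof.
split.
- intros f g; apply C_l_eq; intros x; simpl; unfold cesaro_fun.
  destruct Req_EM_T; [reflexivity |].
  pose proof (is_RInt_unique (V := C_R_CompleteNormedModule) _ _ _ _
             (is_RInt_plus _ _ _ _ _ _ (extend_is_RInt f 0 x) (extend_is_RInt g 0 x))) as E.
  transitivity (RtoC (/ x) *
    (RInt (V := C_R_CompleteNormedModule) (extend f) 0 x +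
     RInt (V := C_R_CompleteNormedModule) (extend g) 0 x))%C; [| ring].
  f_equal; exact E.
- intros c f; apply C_l_eq; intros x; simpl; unfold cesaro_fun.
  destruct Req_EM_T; [reflexivity |].
  pose proof (is_RInt_unique (V := C_R_CompleteNormedModule) _ _ _ _
             (is_RInt_Cscal c _ _ _ _ (extend_is_RInt f 0 x))) as E.
  transitivity (RtoC (/ x) *
    (c * RInt (V := C_R_CompleteNormedModule) (extend f) 0 x))%C.
    f_equal; exact E.
  change mult with Cmult; ring.
- exists 1; split; [lra |]; intros f; rewrite Rmult_1_l.
  apply sup_norm_le; intros x; simpl.
  rewrite <- extend_nonneg.
  replace (extend (cesaro_fun f) x) with (extend (cesaro_fun f) x - 0)%C by ring.
  apply cesaro_fun_minus_le; [apply cond_nonneg |]; intros s _.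
  replace (extend f s - 0)%C with (extend f s) by ring; apply sup_norm_ge.
Qed.

Definition cesaro : bounded_operator C_l_CompleteNormedModule :=
  Build_bounded_operator C_l_CompleteNormedModule cesaro_map cesaro_map_linear.

(* Main.v *)
Require Import Defs.
From Stdlib Require Import Reals Lra ClassicalEpsilon.
From Coquelicot Require Import Coquelicot.
Open Scope R_scope.

(* In the variable [u = ln x] the function [y u = (C f) (exp u)] is the only
   bounded solution of [y' = - y + f o exp] on the real line.  For [lambda <> 0]
   the equation [lambda f - C f = g] therefore becomes
   [y' = - a y + (g o exp) / lambda] with [a = 1 - 1 / lambda] and
   [f = (g + C f) / lambda].  If [Re a <> 0] this has a solution bounded by
   [sup |g| / (|lambda| |Re a|)] that inherits limits at both ends.  The circle
   is [Re a = 0] together with [lambda = 0]; there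
   [y = exp (i s u) / (1 + eps^2 u^2)] provides approximate eigenvectors
   [f = y + y'] for [lambda = 1 / (1 + i s)], and the same functions with [s]
   large show that [C] is not bounded below. *)

(** * Derivatives of complex-valued functions of a real variable *)

(** Taken componentwise, so that the mean value theorem, [auto_derive] and the integration results
    for real functions apply to the real and imaginary parts. *)
Definition cderiv (y : R -> C) (t : R) (l : C) : Prop :=
  is_derive (fun s => Re (y s)) t (Re l) /\ is_derive (fun s => Im (y s)) t (Im l).

Lemma cderiv_eq (y : R -> C) (t : R) (l m : C) : cderiv y t l -> l = m -> cderiv y t m.
Proof. now intros H <-. Qed.

Lemma cderiv_ext (y z : R -> C) (t : R) (l : C) :
  (forall s, y s = z s) -> cderiv y t l -> cderiv z t l.
Proof.
intros E [H1 H2]; split.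
- apply (is_derive_ext (fun s => Re (y s))); [intros s; now rewrite E | exact H1].
- apply (is_derive_ext (fun s => Im (y s))); [intros s; now rewrite E | exact H2].
Qed.

Lemma cderiv_unique (y : R -> C) (t : R) (l m : C) :
  cderiv y t l -> cderiv y t m -> l = m.
Proof.
intros [H1 H2] [K1 K2]; apply injective_projections.
- exact (eq_trans (eq_sym (is_derive_unique _ _ _ H1)) (is_derive_unique _ _ _ K1)).
- exact (eq_trans (eq_sym (is_derive_unique _ _ _ H2)) (is_derive_unique _ _ _ K2)).
Qed.

Lemma cderiv_const (c : C) (t : R) : cderiv (fun _ => c) t 0.
Proof. split; exact (is_derive_const _ t). Qed.

Lemma cderiv_real (g : R -> R) (t l : R) :
  is_derive g t l -> cderiv (fun s => RtoC (g s)) t (RtoC l).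
Proof. intros H; split; [exact H | exact (is_derive_const 0 t)]. Qed.

Lemma cderiv_plus (y z : R -> C) (t : R) (l m : C) :
  cderiv y t l -> cderiv z t m -> cderiv (fun s => y s + z s)%C t (l + m)%C.
Proof.
intros [H1 H2] [K1 K2]; split.
- exact (is_derive_plus _ _ t _ _ H1 K1).
- exact (is_derive_plus _ _ t _ _ H2 K2).
Qed.

Lemma cderiv_mult (y z : R -> C) (t : R) (l m : C) :
  cderiv y t l -> cderiv z t m ->
  cderiv (fun s => y s * z s)%C t (l * z t + y t * m)%C.
Proof.
intros [H1 H2] [K1 K2].
apply is_derive_Reals in H1, H2, K1, K2.
split; apply is_derive_Reals.
- pose proof (derivable_pt_lim_minus _ _ _ _ _
    (derivable_pt_lim_mult _ _ _ _ _ H1 K1) (derivable_pt_lim_mult _ _ _ _ _ H2 K2)) as H.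
  replace (Re (l * z t + y t * m)) with
    (Re l * Re (z t) + Re (y t) * Re m - (Im l * Im (z t) + Im (y t) * Im m))
    by (unfold Re, Im; simpl; ring).
  exact H.
- pose proof (derivable_pt_lim_plus _ _ _ _ _
    (derivable_pt_lim_mult _ _ _ _ _ H1 K2) (derivable_pt_lim_mult _ _ _ _ _ H2 K1)) as H.
  replace (Im (l * z t + y t * m)) with
    (Re l * Im (z t) + Re (y t) * Im m + (Im l * Re (z t) + Im (y t) * Re m))
    by (unfold Re, Im; simpl; ring).
  exact H.
Qed.

Lemma cderiv_scal (c : C) (y : R -> C) (t : R) (l : C) :
  cderiv y t l -> cderiv (fun s => c * y s)%C t (c * l)%C.
Proof.
intros H; apply (cderiv_eq _ _ _ _ (cderiv_mult _ _ _ _ _ (cderiv_const c t) H)); ring.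
Qed.

Lemma cderiv_comp (y : R -> C) (g : R -> R) (t dg : R) (l : C) :
  cderiv y (g t) l -> is_derive g t dg -> cderiv (fun s => y (g s)) t (RtoC dg * l)%C.
Proof.
intros [H1 H2] Hg; split.
- replace (Re (RtoC dg * l)) with (dg * Re l) by (unfold Re, Im; simpl; ring).
  exact (is_derive_comp (fun s => Re (y s)) g t _ _ H1 Hg).
- replace (Im (RtoC dg * l)) with (dg * Im l) by (unfold Re, Im; simpl; ring).
  exact (is_derive_comp (fun s => Im (y s)) g t _ _ H2 Hg).
Qed.

Lemma cderiv_continuous (y : R -> C) (t : R) (l : C) : cderiv y t l -> continuous y t.
Proof.
intros [H1 H2].
apply (continuous_ext (fun s => (Re (y s), Im (y s)))).
  intros s; now destruct (y s).
apply (continuous_comp_2 (fun s => Re (y s)) (fun s => Im (y s)) (fun u v => (u, v))).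
- apply (ex_derive_continuous (fun s => Re (y s))); now exists (Re l).
- apply (ex_derive_continuous (fun s => Im (y s))); now exists (Im l).
- apply (continuous_ext (fun p => p)); [now intros [u v] | apply continuous_id].
Qed.

Lemma continuous_Re (y : R -> C) (t : R) :
  continuous y t -> continuous (fun s => Re (y s)) t.
Proof.
intros H; apply (continuous_comp y (fun z => Re z)); [exact H |].
destruct (y t) as [u v]; exact (continuous_fst u v).
Qed.

Lemma continuous_Im (y : R -> C) (t : R) :
  continuous y t -> continuous (fun s => Im (y s)) t.
Proof.
intros H; apply (continuous_comp y (fun z => Im z)); [exact H |].
destruct (y t) as [u v]; exact (continuous_snd u v).
Qed.

Lemma cderiv_antiderivative (y : R -> C) :
  (forall t, continuous y t) -> exists Y, forall t, cderiv Y t (y t).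
Proof.
intros H.
exists (fun t => (RInt (fun s => Re (y s)) 0 t, RInt (fun s => Im (y s)) 0 t)).
intros t; split; simpl.
- apply (is_derive_RInt (fun s => Re (y s)) _ 0 t).
  + apply filter_forall; intros u.
    apply (RInt_correct (V := R_CompleteNormedModule)).
    apply ex_RInt_continuous; intros z _; apply continuous_Re, H.
  + apply continuous_Re, H.
- apply (is_derive_RInt (fun s => Im (y s)) _ 0 t).
  + apply filter_forall; intros u.
    apply (RInt_correct (V := R_CompleteNormedModule)).
    apply ex_RInt_continuous; intros z _; apply continuous_Im, H.
  + apply continuous_Im, H.
Qed.

(** * The complex exponential as integrating factor *)

(** The function [exp(a t)] of the real variable [t], written out by Euler's formula. *)
Definition cexp (a : C) (t : R) : C :=
  (RtoC (exp (Re a * t)) * (cos (Im a * t), sin (Im a * t)))%C.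

Lemma cexp_0 (a : C) : cexp a 0 = RtoC 1.
Proof.
unfold cexp; rewrite !Rmult_0_r, exp_0, cos_0, sin_0.
apply injective_projections; simpl; ring.
Qed.

Lemma cderiv_cexp (a : C) (t : R) : cderiv (cexp a) t (a * cexp a t)%C.
Proof.
split; unfold cexp, Re, Im; simpl; auto_derive; trivial; unfold Re, Im; simpl; ring.
Qed.

Lemma Cmod_cexp (a : C) (t : R) : Cmod (cexp a t) = exp (Re a * t).
Proof.
unfold cexp; rewrite Cmod_mult, Cmod_R, Rabs_pos_eq by apply Rlt_le, exp_pos.
replace (Cmod (cos (Im a * t), sin (Im a * t))) with 1; [ring |].
unfold Cmod; simpl fst; simpl snd.
rewrite <- !Rsqr_pow2, Rplus_comm, sin2_cos2; symmetry; apply sqrt_1.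
Qed.

Lemma cexp_opp (a : C) (t : R) : (cexp (- a) t * cexp a t = 1)%C.
Proof.
unfold cexp.
change (Re (- a)) with (- Re a); change (Im (- a)) with (- Im a).
rewrite !Ropp_mult_distr_l_reverse, cos_neg, sin_neg, exp_Ropp.
pose proof (sin2_cos2 (Im a * t)) as H; unfold Rsqr in H.
pose proof (exp_pos (Re a * t)) as He.
set (e := exp _) in *; set (c := cos _) in *; set (s := sin _) in *.
apply injective_projections; simpl.
- transitivity (s * s + c * c); [field; lra | exact H].
- field; lra.
Qed.

(** * A priori estimates for [y' = - a y + psi] *)

(** The mean value theorem fails for complex values, so it is applied to a real function: the
    majorant [B] scaled by [|D|], minus the scalar product of [G] with its own total increment [D].
    By Cauchy-Schwarz this function is nondecreasing, and its increment is
    [|D| (B u - B w) - |D|^2]. *)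
Lemma cderiv_increment_le (G g : R -> C) (B b : R -> R) (w u : R) : w <= u ->
  (forall t, cderiv G t (g t)) -> (forall t, is_derive B t (b t)) ->
  (forall t, w <= t <= u -> Cmod (g t) <= b t) ->
  Cmod (G u - G w) <= B u - B w.
Proof.
intros Hwu HG HB Hgb.
set (D := (G u - G w)%C).
(* Settles the case [D = 0], where the final division by [Cmod D] is impossible. *)
assert (HB' : 0 <= B u - B w).
{ destruct (MVT_gen B w u b) as [c [Hc E]].
  - intros; apply HB.
  - intros x _; apply continuity_pt_filterlim, (ex_derive_continuous B); exists (b x); apply HB.
  - rewrite Rmin_left, Rmax_right in Hc by lra.
    simpl in E; rewrite E; apply Rmult_le_pos; [| lra].
    exact (Rle_trans _ _ _ (Cmod_ge_0 _) (Hgb c Hc)). }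
pose (r := fun t => Cmod D * B t - (Re D * Re (G t) + Im D * Im (G t))).
assert (Hr : forall t, is_derive r t
          (Cmod D * b t - (Re D * Re (g t) + Im D * Im (g t)))).
{ intros t; destruct (HG t) as [H1 H2]; specialize (HB t).
  pose (p := fun s => Re (G s)); pose (q := fun s => Im (G s)).
  change (is_derive p t (Re (g t))) in H1; change (is_derive q t (Im (g t))) in H2.
  change (is_derive (fun t => Cmod D * B t - (Re D * p t + Im D * q t)) t
            (Cmod D * b t - (Re D * Re (g t) + Im D * Im (g t)))).
  clearbody p q; clear r; clearbody D; auto_derive.
  - repeat split; eexists; [exact HB | exact H1 | exact H2].
  - replace (Derive (fun x => B x) t) with (b t) by exact (eq_sym (is_derive_unique _ _ _ HB)).
    replace (Derive (fun x => p x) t) with (Re (g t)) by exact (eq_sym (is_derive_unique _ _ _ H1)).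
    replace (Derive (fun x => q x) t) with (Im (g t)) by exact (eq_sym (is_derive_unique _ _ _ H2)).
 ring. }
destruct (MVT_gen r w u _ (fun t _ => Hr t)) as [c [Hc E]].
  intros x _; apply continuity_pt_filterlim, (ex_derive_continuous r); eexists; apply Hr.
rewrite Rmin_left, Rmax_right in Hc by lra.
assert (H1 : Re D * Re (g c) + Im D * Im (g c) <= Cmod D * b c).
{ apply Rle_trans with (Cmod D * Cmod (g c));
    [| apply Rmult_le_compat_l; [apply Cmod_ge_0 | now apply Hgb]].
  (* The scalar product of [D] and [g c] is the real part of [conj D * g c]. *)
  rewrite <- (Cmod_conj D), <- Cmod_mult.
  apply Rle_trans with (2 := re_le_Cmod _), Rle_trans with (2 := Rle_abs _).
  apply Req_le; unfold Re, Im; simpl; ring. }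
assert (H2 : 0 <= r u - r w).
{ rewrite E; apply Rmult_le_pos; lra. }
assert (H3 : r u - r w = Cmod D * (B u - B w) - (Cmod D * Cmod D)).
{ replace (Cmod D * Cmod D) with (Re D * Re D + Im D * Im D).
    unfold r, D, Re, Im; simpl; ring.
  unfold Cmod; rewrite sqrt_sqrt.
    unfold Re, Im; ring.
  apply Rplus_le_le_0_compat; apply pow2_ge_0. }
destruct (Cmod_ge_0 D) as [Hp | Hp]; [| fold D; lra].
apply Rmult_le_reg_l with (1 := Hp); fold D; lra.
Qed.

(* After multiplication by the integrating factor [exp(a t)] the right-hand side
   is [exp(a t) psi], whose modulus is the derivative of [M exp(Re a t) / Re a]. *)
Lemma linear_ode_decay (a : C) (z psi : R -> C) (M w u : R) :
  0 < Re a -> w <= u ->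
  (forall t, cderiv z t (- a * z t + psi t)%C) ->
  (forall t, w <= t <= u -> Cmod (psi t) <= M) ->
  Cmod (z u) <= exp (- Re a * (u - w)) * Cmod (z w) + M / Re a.
Proof.
intros Ha Hwu Hz Hpsi.
pose proof (exp_pos (Re a * u)) as Eu; pose proof (exp_pos (Re a * w)) as Ew.
assert (HM : 0 <= M) by exact (Rle_trans _ _ _ (Cmod_ge_0 _) (Hpsi w (conj (Rle_refl w) Hwu))).
assert (HMa : 0 <= M / Re a) by (apply Rdiv_le_0_compat; lra).
assert (H : Cmod (cexp a u * z u - cexp a w * z w) <=
            M / Re a * exp (Re a * u) - M / Re a * exp (Re a * w)).
{ apply (cderiv_increment_le (fun t => cexp a t * z t)%C (fun t => cexp a t * psi t)%C
           (fun t => M / Re a * exp (Re a * t)) (fun t => M * exp (Re a * t))); trivial.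
  - intros t; refine (cderiv_eq _ _ _ _ (cderiv_mult _ _ _ _ _ (cderiv_cexp a t) (Hz t)) _).
    ring.
  - intros t; auto_derive; trivial; field; lra.
  - intros t Ht; rewrite Cmod_mult, Cmod_cexp, Rmult_comm.
    apply Rmult_le_compat_r; [apply Rlt_le, exp_pos | now apply Hpsi]. }
pose proof (Cmod_triangle (cexp a u * z u - cexp a w * z w) (cexp a w * z w)) as T.
replace (cexp a u * z u - cexp a w * z w + cexp a w * z w)%C with (cexp a u * z u)%C in T by ring.
rewrite !Cmod_mult, !Cmod_cexp in T.
apply Rmult_le_reg_l with (1 := Eu).
replace (exp (- Re a * (u - w))) with (exp (Re a * w) / exp (Re a * u)).
2:{ unfold Rdiv; rewrite <- exp_Ropp, <- exp_plus; f_equal; ring. }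
apply Rle_trans with (exp (Re a * w) * Cmod (z w) + exp (Re a * u) * (M / Re a)).
- pose proof (Rmult_le_pos _ _ HMa (Rlt_le _ _ Ew)); lra.
- apply Req_le; field; lra.
Qed.

(** The product [exp(a t) z] has derivative zero, so it is constant by the increment estimate with
    zero majorant. The formula holds for [w] on either side of [u]; the eigenvector argument lets
    [w] tend to either end of the line. *)
Lemma linear_ode_homogeneous (a : C) (z : R -> C) :
  (forall t, cderiv z t (- a * z t)%C) ->
  forall w u, Cmod (z u) = exp (- Re a * (u - w)) * Cmod (z w).
Proof.
intros Hz w u.
assert (K : forall p q, p <= q -> (cexp a q * z q = cexp a p * z p)%C).
{ intros p q Hpq.
  assert (H : Cmod (cexp a q * z q - cexp a p * z p) <= 0 - 0).
  { apply (cderiv_increment_le (fun t => cexp a t * z t)%C (fun _ => RtoC 0)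
             (fun _ => 0) (fun _ => 0)); trivial.
    - intros t; refine (cderiv_eq _ _ _ _ (cderiv_mult _ _ _ _ _ (cderiv_cexp a t) (Hz t)) _).
      ring.
    - intros t; apply (is_derive_const 0 t).
    - intros; rewrite Cmod_0; lra. }
  assert (E : (cexp a q * z q - cexp a p * z p = 0)%C).
  { apply Cmod_eq_0; pose proof (Cmod_ge_0 (cexp a q * z q - cexp a p * z p)); lra. }
  replace (cexp a q * z q)%C with
    ((cexp a q * z q - cexp a p * z p) + cexp a p * z p)%C by ring.
  rewrite E; ring. }
assert (E : (cexp a u * z u = cexp a w * z w)%C).
{ destruct (Rle_lt_dec w u); [| symmetry]; apply K; lra. }
apply (f_equal Cmod) in E; rewrite !Cmod_mult, !Cmod_cexp in E.
replace (exp (- Re a * (u - w))) with (exp (Re a * w) / exp (Re a * u)).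
2:{ unfold Rdiv; rewrite <- exp_Ropp, <- exp_plus; f_equal; ring. }
pose proof (exp_pos (Re a * u)).
apply Rmult_eq_reg_l with (exp (Re a * u)); [rewrite E; field |]; lra.
Qed.

(** * Bounded solutions of the linear equation and their limits *)

Lemma continuous_Cmult (y z : R -> C) (t : R) :
  continuous y t -> continuous z t -> continuous (fun s => y s * z s)%C t.
Proof.
intros Hy Hz.
pose proof (continuous_Re _ _ Hy) as Hy1; pose proof (continuous_Im _ _ Hy) as Hy2.
pose proof (continuous_Re _ _ Hz) as Hz1; pose proof (continuous_Im _ _ Hz) as Hz2.
apply (continuous_comp_2 (fun s => Re (y s) * Re (z s) - Im (y s) * Im (z s))
         (fun s => Re (y s) * Im (z s) + Im (y s) * Re (z s)) (fun u v => (u, v))).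
- exact (continuous_minus _ _ _ (continuous_mult _ _ _ Hy1 Hz1) (continuous_mult _ _ _ Hy2 Hz2)).
- exact (continuous_plus _ _ _ (continuous_mult _ _ _ Hy1 Hz2) (continuous_mult _ _ _ Hy2 Hz1)).
- apply (continuous_ext (fun p => p)); [now intros [u v] | apply continuous_id].
Qed.

Lemma exp_small_m_infty (b eps : R) : 0 < b -> 0 < eps ->
  exists A, forall t, t < A -> exp (b * t) < eps.
Proof.
intros Hb He; exists (ln eps / b); intros t Ht.
rewrite <- (exp_ln eps He); apply exp_increasing.
apply Rmult_lt_compat_l with (r := b) in Ht; [| exact Hb].
replace (b * (ln eps / b)) with (ln eps) in Ht by (field; lra); exact Ht.
Qed.

(** Let the initial time [w] in [linear_ode_decay] tend to -oo: the initial value stays below [K]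
    and its factor vanishes. Only values of [psi] before [u] enter, which also serves to compute
    limits at -oo. *)
Lemma linear_ode_bounded_le (a : C) (y psi : R -> C) (K M u : R) :
  0 < Re a ->
  (forall t, cderiv y t (- a * y t + psi t)%C) ->
  (forall t, Cmod (y t) <= K) ->
  (forall t, t <= u -> Cmod (psi t) <= M) ->
  Cmod (y u) <= M / Re a.
Proof.
intros Ha Hy HK HM.
assert (HK0 : 0 <= K) by exact (Rle_trans _ _ _ (Cmod_ge_0 _) (HK 0)).
apply le_epsilon; intros eps He.
(* Chosen so that [exp (- Re a * (u - w)) <= eps / (K + 1)] for [w < A]; the 1 keeps the denominator
   positive when [K = 0]. *)
destruct (exp_small_m_infty (Re a) (exp (Re a * u) * (eps / (K + 1)))) as [A HA].
- exact Ha.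
- apply Rmult_lt_0_compat; [apply exp_pos | apply Rdiv_lt_0_compat; lra].
- set (w := Rmin A u - 1).
  assert (Hw : w < A /\ w <= u).
  { unfold w; pose proof (Rmin_l A u); pose proof (Rmin_r A u); lra. }
  pose proof (linear_ode_decay a y psi M w u Ha (proj2 Hw) Hy (fun t H => HM t (proj2 H))) as H.
  specialize (HA w (proj1 Hw)).
  assert (E : exp (- Re a * (u - w)) <= eps / (K + 1)).
  { apply Rlt_le, Rmult_lt_reg_l with (1 := exp_pos (Re a * u)).
    rewrite <- exp_plus; eapply Rle_lt_trans with (2 := HA).
    apply Req_le; f_equal; ring. }
  assert (E2 : exp (- Re a * (u - w)) * Cmod (y w) <= eps / (K + 1) * (K + 1)).
  { apply Rmult_le_compat; trivial.
    - apply Rlt_le, exp_pos.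
    - apply Cmod_ge_0.
    - specialize (HK w); lra. }
  replace (eps / (K + 1) * (K + 1)) with eps in E2 by (field; lra); lra.
Qed.

(** Variation of constants from -oo: [y t] is [exp(- a t)] times the integral of [exp(a s) phi(s)]
    over [s <= t]. The improper integral is obtained as [G t - L], with [G] an antiderivative and
    [L] its limit at -oo. *)
Lemma linear_ode_bounded_exists (a : C) (phi : R -> C) (M : R) :
  0 < Re a -> (forall t, continuous phi t) -> (forall t, Cmod (phi t) <= M) ->
  exists y, (forall t, cderiv y t (- a * y t + phi t)%C) /\
    forall t, Cmod (y t) <= M / Re a.
Proof.
intros Ha Hc HM.
assert (HM0 : 0 <= M) by exact (Rle_trans _ _ _ (Cmod_ge_0 _) (HM 0)).
assert (HMa : 0 <= M / Re a) by (apply Rdiv_le_0_compat; lra).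
destruct (cderiv_antiderivative (fun t => cexp a t * phi t)%C) as [G HG].
{ intros t; apply continuous_Cmult; [| apply Hc].
  apply cderiv_continuous with (1 := cderiv_cexp a t). }
(* The bound is uniform in [w] and tends to 0 as [u] tends to -oo, so [G] is Cauchy there. *)
assert (Hinc : forall w u, w <= u -> Cmod (G u - G w) <= M / Re a * exp (Re a * u)).
{ intros w u Hwu.
  apply Rle_trans with (M / Re a * exp (Re a * u) - M / Re a * exp (Re a * w)).
  - apply (cderiv_increment_le G (fun t => cexp a t * phi t)%C
      (fun t => M / Re a * exp (Re a * t)) (fun t => M * exp (Re a * t))); trivial.
    + intros t; auto_derive; trivial; field; lra.
    + intros t Ht; rewrite Cmod_mult, Cmod_cexp, Rmult_comm.
      apply Rmult_le_compat_r; [apply Rlt_le, exp_pos | apply HM].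
  - pose proof (Rmult_le_pos _ _ HMa (Rlt_le _ _ (exp_pos (Re a * w)))); lra. }
assert (HL : exists L : C, filterlim G (Rbar_locally m_infty) (locally L)).
{ apply (@filterlim_locally_cauchy R C_R_CompleteNormedModule _
           (Rbar_locally_filter m_infty)).
  intros eps.
  destruct (exp_small_m_infty (Re a) (eps / (M / Re a + 1)) Ha) as [A HA].
    apply Rdiv_lt_0_compat; [apply cond_pos | lra].
  exists (fun t => t < A); split; [now exists A |]; intros u v Hu Hv.
  apply (@norm_compat1 C_AbsRing C_NormedModule).
  change (Cmod (G v - G u) < eps).
  assert (Hexp : forall t, t < A -> M / Re a * exp (Re a * t) < eps).
  { intros t Ht; specialize (HA t Ht); pose proof (exp_pos (Re a * t)).
    apply Rmult_lt_compat_l with (r := M / Re a + 1) in HA; [| lra].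
    replace ((M / Re a + 1) * (eps / (M / Re a + 1))) with (pos eps) in HA by (field; lra).
    lra. }
  destruct (Rle_lt_dec u v) as [H | H].
  - apply Rle_lt_trans with (1 := Hinc u v H), Hexp, Hv.
  - replace (G v - G u)%C with (- (G u - G v))%C by ring; rewrite Cmod_opp.
    apply Rle_lt_trans with (1 := Hinc v u (Rlt_le _ _ H)), Hexp, Hu. }
destruct HL as [L HL].
assert (HGL : forall u, Cmod (G u - L) <= M / Re a * exp (Re a * u)).
{ intros u; apply le_epsilon; intros eps He.
  rewrite filterlim_C in HL by apply Rbar_locally_filter.
  destruct (HL (mkposreal eps He)) as [A HA]; simpl in HA.
  set (w := Rmin A u - 1).
  assert (Hw : w < A /\ w <= u).
  { unfold w; pose proof (Rmin_l A u); pose proof (Rmin_r A u); lra. }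
  pose proof (Cmod_triangle (G u - G w) (G w - L)) as T.
  replace (G u - G w + (G w - L))%C with (G u - L)%C in T by ring.
  pose proof (Hinc w u (proj2 Hw)); specialize (HA w (proj1 Hw)); lra. }
exists (fun t => cexp (- a) t * (G t + (- L)))%C; split; intros t.
- refine (cderiv_eq _ _ _ _ (cderiv_mult _ _ _ _ _ (cderiv_cexp (- a) t)
    (cderiv_plus _ _ _ _ _ (HG t) (cderiv_const (- L) t))) _).
  transitivity (- a * (cexp (- a) t * (G t + - L)) + (cexp (- a) t * cexp a t) * phi t)%C;
    [ring | rewrite cexp_opp; ring].
- rewrite Cmod_mult, Cmod_cexp; specialize (HGL t).
  change (Re (- a)) with (- Re a); rewrite Ropp_mult_distr_l_reverse, exp_Ropp.
  pose proof (exp_pos (Re a * t)) as He.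
  apply Rmult_le_reg_l with (1 := He).
  rewrite <- Rmult_assoc, Rinv_r, Rmult_1_l by lra.
  rewrite Rmult_comm; exact HGL.
Qed.

(** The constant [c / a] is the stationary solution for the constant forcing [c]; subtracting it
    reduces limit statements to forcing that tends to 0. *)
Lemma linear_ode_shift (a c : C) (y phi : R -> C) : a <> 0 ->
  (forall t, cderiv y t (- a * y t + phi t)%C) ->
  forall t, cderiv (fun s => y s + - (c / a))%C t
    (- a * (y t + - (c / a)) + (phi t + - c))%C.
Proof.
intros Ha Hy t.
refine (cderiv_eq _ _ _ _ (cderiv_plus _ _ _ _ _ (Hy t) (cderiv_const (- (c / a)) t)) _).
field; exact Ha.
Qed.

(** After the shift the solution is still bounded and its forcing is small on a left half-line, so
    [linear_ode_bounded_le] makes it small there. *)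
Lemma linear_ode_limit_m_infty (a c : C) (y phi : R -> C) (K : R) :
  0 < Re a ->
  (forall t, cderiv y t (- a * y t + phi t)%C) -> (forall t, Cmod (y t) <= K) ->
  filterlim phi (Rbar_locally m_infty) (locally c) ->
  filterlim y (Rbar_locally m_infty) (locally (c / a)%C).
Proof.
intros Ha Hy HK Hphi.
assert (Ha0 : a <> 0) by (intros ->; simpl in Ha; lra).
rewrite filterlim_C in Hphi by apply Rbar_locally_filter.
rewrite filterlim_C by apply Rbar_locally_filter; intros eps; pose proof (cond_pos eps) as He.
assert (He2 : 0 < eps / 2 * Re a) by (apply Rmult_lt_0_compat; lra).
destruct (Hphi (mkposreal _ He2)) as [A HA]; simpl in HA.
exists A; intros u Hu.
apply Rle_lt_trans with (eps / 2 * Re a / Re a).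
- apply (linear_ode_bounded_le a (fun s => y s + - (c / a))%C (fun s => phi s + - c)%C
           (K + Cmod (- (c / a))) _ u Ha).
  + now apply linear_ode_shift.
  + intros t; eapply Rle_trans; [apply Cmod_triangle | specialize (HK t); lra].
  + intros t Ht; apply Rlt_le, HA; lra.
- replace (eps / 2 * Re a / Re a) with (eps / 2) by (field; lra); lra.
Qed.

(** After the shift, start at a time [w] beyond which the forcing is small: the value at [w] is
    damped exponentially, and the forcing contributes at most [eps / 2]. *)
Lemma linear_ode_limit_p_infty (a c : C) (y phi : R -> C) :
  0 < Re a ->
  (forall t, cderiv y t (- a * y t + phi t)%C) ->
  filterlim phi (Rbar_locally p_infty) (locally c) ->
  filterlim y (Rbar_locally p_infty) (locally (c / a)%C).
Proof.
intros Ha Hy Hphi.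
assert (Ha0 : a <> 0) by (intros ->; simpl in Ha; lra).
rewrite filterlim_C in Hphi by apply Rbar_locally_filter.
rewrite filterlim_C by apply Rbar_locally_filter; intros eps; pose proof (cond_pos eps) as He.
assert (He2 : 0 < eps / 2 * Re a) by (apply Rmult_lt_0_compat; lra).
destruct (Hphi (mkposreal _ He2)) as [A HA]; simpl in HA.
set (w := A + 1); set (k := Cmod (y w + - (c / a))).
assert (Hk : 0 <= k) by apply Cmod_ge_0.
destruct (exp_small_m_infty (Re a) (eps / 2 / (k + 1)) Ha) as [B HB].
  apply Rdiv_lt_0_compat; lra.
(* The second bound gives [w - u < B], which makes the damping factor smaller than
   [eps / 2 / (k + 1)]. *)
exists (Rmax w (w - B)); intros u Hu.
pose proof (Rmax_l w (w - B)); pose proof (Rmax_r w (w - B)).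
pose proof (linear_ode_decay a _ _ (eps / 2 * Re a) w u Ha ltac:(lra)
  (linear_ode_shift a c y phi Ha0 Hy)) as H1.
lapply H1; [clear H1; intros H1 | intros t Ht; apply Rlt_le, HA; unfold w in Ht; lra].
change (Cmod (y u + - (c / a)) < eps).
fold k in H1.
replace (eps / 2 * Re a / Re a) with (eps / 2) in H1 by (field; lra).
specialize (HB (w - u) ltac:(lra)).
replace (Re a * (w - u)) with (- Re a * (u - w)) in HB by ring.
set (e := exp _) in *.
assert (He0 : 0 < e) by apply exp_pos.
apply Rmult_lt_compat_r with (r := k + 1) in HB; [| lra].
replace (eps / 2 / (k + 1) * (k + 1)) with (eps / 2) in HB by (field; lra).
lra.
Qed.

(** The form that [C_l] takes in the variable [u = ln x]: the limit at -oo stands for the value at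
    0, the limit at +oo for the value at infinity. *)
Definition continuous_with_limits (phi : R -> C) : Prop :=
  (forall t, continuous phi t) /\
  (exists l : C, filterlim phi (Rbar_locally m_infty) (locally l)) /\
  (exists l : C, filterlim phi (Rbar_locally p_infty) (locally l)).

Lemma linear_ode_solution_pos (a : C) (phi : R -> C) (M : R) :
  0 < Re a -> continuous_with_limits phi -> (forall t, Cmod (phi t) <= M) ->
  exists y, continuous_with_limits y /\
    (forall t, cderiv y t (- a * y t + phi t)%C) /\
    forall t, Cmod (y t) <= M / Re a.
Proof.
intros Ha [Hc [[l Hl] [m Hm]]] HM.
destruct (linear_ode_bounded_exists a phi M Ha Hc HM) as [y [Hy Hb]].
exists y; split; [split; [| split] | now split].
- intros t; apply cderiv_continuous with (1 := Hy t).
- exists (l / a)%C; now apply linear_ode_limit_m_infty with (phi := phi) (K := M / Re a).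
- exists (m / a)%C; now apply linear_ode_limit_p_infty with (phi := phi).
Qed.

Lemma continuous_with_limits_reflect (phi : R -> C) :
  continuous_with_limits phi -> continuous_with_limits (fun t => phi (- t)).
Proof.
intros [Hc [[l Hl] [m Hm]]]; repeat split.
- intros t; apply (continuous_comp Ropp phi); [| apply Hc].
  apply (continuous_opp (fun s : R => s)), continuous_id.
- exists m; exact (filterlim_comp _ _ _ Ropp phi _ _ _ (filterlim_Rbar_opp m_infty) Hm).
- exists l; exact (filterlim_comp _ _ _ Ropp phi _ _ _ (filterlim_Rbar_opp p_infty) Hl).
Qed.

Lemma continuous_with_limits_scal (c : C) (phi : R -> C) :
  continuous_with_limits phi -> continuous_with_limits (fun t => c * phi t)%C.
Proof.
assert (H : forall (F : (R -> Prop) -> Prop) (l : C), filterlim phi F (locally l) ->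
          filterlim (fun t => c * phi t)%C F (locally (c * l)%C)).
{ intros F l Hl; refine (filterlim_comp _ _ _ phi _ _ _ _ Hl _).
  exact (@filterlim_scal_r C_AbsRing C_NormedModule c l). }
intros [Hc [[l Hl] [m Hm]]]; split; [| split].
- intros t; exact (H _ _ (Hc t)).
- exists (c * l)%C; now apply H.
- exists (c * m)%C; now apply H.
Qed.

(** For [Re a < 0] time is reversed: if [y] solves the equation for [- a] and [phi(- t)], then
    [- y(- t)] solves it for [a] and [phi]. *)
Lemma linear_ode_solution (a : C) (phi : R -> C) (M : R) :
  Re a <> 0 -> continuous_with_limits phi -> (forall t, Cmod (phi t) <= M) ->
  exists y, continuous_with_limits y /\
    (forall t, cderiv y t (- a * y t + phi t)%C) /\
    forall t, Cmod (y t) <= M / Rabs (Re a).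
Proof.
intros Ha Hphi HM.
destruct (Rle_lt_dec (Re a) 0) as [Hneg | Hpos].
2:{ rewrite Rabs_pos_eq by lra; now apply linear_ode_solution_pos. }
destruct (linear_ode_solution_pos (- a) (fun t => phi (- t)) M) as [y [Hy [Hd Hb]]].
- change (Re (- a)) with (- Re a); lra.
- now apply continuous_with_limits_reflect.
- intros t; apply HM.
- change (Re (- a)) with (- Re a) in Hb.
  rewrite Rabs_left by lra.
  exists (fun t => - (1) * y (- t)%R)%C; split; [| split].
  + now apply continuous_with_limits_scal, continuous_with_limits_reflect.
  + intros t.
    assert (Hopp : is_derive Ropp t (- (1))) by (auto_derive; [trivial | ring]).
    refine (cderiv_eq _ _ _ _ (cderiv_scal _ _ _ _ (cderiv_comp y Ropp t _ _ (Hd (- t)) Hopp)) _).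
    rewrite RtoC_opp, Ropp_involutive; ring.
  + intros t; rewrite Cmod_mult, Cmod_opp, Cmod_1, Rmult_1_l; apply Hb.
Qed.

(** * The substitution [x = exp u] *)

Lemma extend_exp_limits (f : C_l) : continuous_with_limits (fun u => extend f (exp u)).
Proof.
split; [| split].
- intros t; apply (continuous_comp exp (extend f)); [| apply extend_continuous].
  apply (ex_derive_continuous exp); exists (exp t); apply is_derive_exp.
- exists (extend f 0).
  exact (filterlim_comp _ _ _ exp (extend f) _ _ _ is_lim_exp_m (extend_continuous f 0)).
- destruct (C_l_limit f) as [l Hl]; exists l.
  exact (filterlim_comp _ _ _ exp (extend f) _ _ _ is_lim_exp_p Hl).
Qed.

(** Inverts the substitution by [f x = phi (ln x)]; continuity at 0 forces [f 0] to be the limit of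
    [phi] at -oo. *)
Lemma C_l_of_log (phi : R -> C) : continuous_with_limits phi ->
  exists f : C_l, forall u, extend f (exp u) = phi u.
Proof.
intros [Hc [[l Hl] [m Hm]]].
pose (f := fun x : nonnegreal => if Req_EM_T x 0 then l else phi (ln x)).
assert (Hf : forall t, 0 < t -> extend f t = phi (ln t)).
{ intros t Ht; unfold f, extend; simpl; rewrite Rmax_right by lra.
  destruct Req_EM_T; [lra | reflexivity]. }
assert (Hf0 : extend f 0 = l).
{ unfold f, extend; simpl; rewrite Rmax_right by lra.
  destruct Req_EM_T; [reflexivity | lra]. }
assert (Cf : continuous_on (fun t : R => 0 <= t) (extend f)).
{ intros t [Ht | <-].
  - eapply filterlim_filter_le_1; [apply filter_le_within |].
    rewrite (Hf t Ht).
    apply (filterlim_ext_loc (fun s => phi (ln s))).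
      apply (locally_interval _ t 0 p_infty); simpl; trivial.
      intros s Hs _; symmetry; now apply Hf.
    apply (continuous_comp ln phi); [| apply Hc].
    apply (ex_derive_continuous ln); exists (/ t); now apply is_derive_ln.
  - rewrite filterlim_C by apply within_filter, locally_filter; intros eps.
    rewrite filterlim_C in Hl by apply Rbar_locally_filter.
    destruct (Hl eps) as [A HA].
    exists (mkposreal _ (exp_pos A)); intros t Ht Ht0; rewrite Hf0.
    destruct Ht0 as [Ht0 | <-].
    + rewrite Hf by exact Ht0; apply HA.
      rewrite <- (ln_exp A); apply ln_increasing; [exact Ht0 |].
      apply Rabs_def2 in Ht; unfold minus, plus, opp in Ht; simpl in Ht; lra.
    + rewrite Hf0; replace (l - l)%C with (RtoC 0) by ring.
      rewrite Cmod_0; apply cond_pos. }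
assert (Lf : exists l : C, filterlim (extend f) (Rbar_locally p_infty) (locally l)).
{ exists m; rewrite filterlim_C in Hm |- * by apply Rbar_locally_filter.
  intros eps; destruct (Hm eps) as [A HA]; exists (exp A); intros t Ht.
  pose proof (exp_pos A).
  rewrite Hf by lra; apply HA.
  rewrite <- (ln_exp A); now apply ln_increasing. }
exists (Build_C_l f Cf Lf); intros u; simpl.
rewrite Hf by apply exp_pos; now rewrite ln_exp.
Qed.

Lemma Cmod_extend_le (f : C_l) (t : R) : Cmod (extend f t) <= sup_norm f.
Proof. apply sup_norm_ge. Qed.

(** The substitution misses only [x = 0], where the bound follows by continuity. *)
Lemma sup_norm_exp_le (f : C_l) (M : R) :
  (forall u, Cmod (extend f (exp u)) <= M) -> sup_norm f <= M.
Proof.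
intros HM.
assert (Hp : forall t, 0 < t -> Cmod (extend f t) <= M).
{ intros t Ht; rewrite <- (exp_ln t Ht); apply HM. }
apply sup_norm_le; intros x; rewrite <- extend_nonneg.
destruct (cond_nonneg x) as [Hx | <-]; [now apply Hp |].
apply le_epsilon; intros eps He.
pose proof (extend_continuous f 0) as Cf; unfold continuous in Cf.
rewrite filterlim_C in Cf by apply locally_filter.
destruct (Cf (mkposreal eps He)) as [d Hd]; simpl in Hd.
pose proof (cond_pos d).
specialize (Hp (d / 2) ltac:(lra)).
assert (Hb : ball 0 d (d / 2)).
{ apply Rabs_def1; unfold minus, plus, opp; simpl; lra. }
specialize (Hd _ Hb).
pose proof (Cmod_triangle (- (extend f (d / 2) - extend f 0)) (extend f (d / 2))) as T.
replace (- (extend f (d / 2) - extend f 0) + extend f (d / 2))%C with (extend f 0) in T by ring.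
rewrite Cmod_opp in T; lra.
Qed.

Lemma C_l_eq_exp (f g : C_l) :
  (forall u, extend f (exp u) = extend g (exp u)) -> f = g.
Proof.
intros H; apply C_l_eq; intros x.
assert (K : sup_norm (minus f g) <= 0).
{ apply sup_norm_exp_le; intros u.
  replace (extend (minus f g) (exp u)) with (RtoC 0); [rewrite Cmod_0; lra |].
  transitivity (extend f (exp u) - extend g (exp u))%C; [rewrite H; ring |].
  symmetry; exact (C_l_minusE f g _). }
pose proof (sup_norm_ge (minus f g) x) as Hx; rewrite C_l_minusE in Hx.
assert (E : (f x - g x = 0)%C).
{ apply Cmod_eq_0; pose proof (Cmod_ge_0 (f x - g x)); lra. }
replace (f x) with ((f x - g x) + g x)%C by ring; rewrite E; ring.
Qed.

(** * The Cesàro operator as a differential equation *)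

(** With [F] the integral of [f] from 0, [C f (exp u) = exp(- u) F(exp u)]; the product and chain
    rules give the equation. *)
Lemma cesaro_ode (f : C_l) (u : R) :
  cderiv (fun s => extend (cesaro f) (exp s)) u
    (- (1) * extend (cesaro f) (exp u) + extend f (exp u))%C.
Proof.
set (F := fun t => RInt (V := C_R_CompleteNormedModule) (extend f) 0 t).
assert (HF : forall t, cderiv F t (extend f t)).
{ intros t; split.
  - apply (is_derive_RInt (fun s => Re (extend f s)) (fun s => Re (F s)) 0 t).
    + apply filter_forall; intros v.
      exact (is_RInt_fct_extend_fst _ _ _ _ (extend_is_RInt f 0 v)).
    + apply continuous_Re, extend_continuous.
  - apply (is_derive_RInt (fun s => Im (extend f s)) (fun s => Im (F s)) 0 t).
    + apply filter_forall; intros v.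
      exact (is_RInt_fct_extend_snd _ _ _ _ (extend_is_RInt f 0 v)).
    + apply continuous_Im, extend_continuous. }
assert (E : forall s, extend (cesaro f) (exp s) = (RtoC (exp (- s)) * F (exp s))%C).
{ intros s; rewrite exp_Ropp; exact (cesaro_fun_pos f (exp s) (exp_pos s)). }
apply cderiv_ext with (y := fun s => (RtoC (exp (- s)) * F (exp s))%C).
  intros s; symmetry; apply E.
rewrite E.
assert (H1 : is_derive (fun s => exp (- s)) u (- exp (- u))) by (auto_derive; [trivial | ring]).
refine (cderiv_eq _ _ _ _ (cderiv_mult _ _ _ _ _ (cderiv_real _ _ _ H1)
          (cderiv_comp F exp u _ _ (HF (exp u)) (is_derive_exp u))) _).
transitivity (- (1) * (RtoC (exp (- u)) * F (exp u)) +
  RtoC (exp (- u) * exp u) * extend f (exp u))%C.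
- rewrite RtoC_opp, RtoC_mult; ring.
- rewrite <- exp_plus, Rplus_opp_l, exp_0; ring.
Qed.

(** The difference of [C f] and [h] is a bounded solution of [d' = - d] on the whole line, hence
    zero. This identifies [C f] without evaluating an integral. *)
Lemma cesaro_eq_of_ode (f h : C_l) :
  (forall u, cderiv (fun s => extend h (exp s)) u
     (- (1) * extend h (exp u) + extend f (exp u))%C) ->
  cesaro f = h.
Proof.
intros Hh; apply C_l_eq_exp; intros u.
set (d := fun s => (extend (cesaro f) (exp s) + - (1) * extend h (exp s))%C).
assert (Hd : Cmod (d u) <= 0 / Re 1).
{ apply (linear_ode_bounded_le 1 d (fun _ => RtoC 0) (sup_norm (cesaro f) + sup_norm h)).
  - simpl; lra.
  - intros t; refine (cderiv_eq _ _ _ _ (cderiv_plus _ _ _ _ _ (cesaro_ode f t)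
      (cderiv_scal (- (1)) _ _ _ (Hh t))) _).
    unfold d; ring.
  - intros t; eapply Rle_trans; [apply Cmod_triangle |].
    rewrite Cmod_mult, Cmod_opp, Cmod_1, Rmult_1_l.
    apply Rplus_le_compat; apply Cmod_extend_le.
  - intros t _; rewrite Cmod_0; lra. }
assert (E : d u = 0).
{ apply Cmod_eq_0; pose proof (Cmod_ge_0 (d u)); simpl in Hd; lra. }
replace (extend (cesaro f) (exp u)) with (d u + extend h (exp u))%C by (unfold d; ring).
rewrite E; ring.
Qed.

(** * Solving the resolvent equation off the circle *)

Lemma scalar_minus_cesaroE (lambda : C) (f : C_l) (x : nonnegreal) :
  (scalar_minus lambda cesaro f : C_l) x = (lambda * f x - cesaro f x)%C.
Proof. exact (C_l_minusE _ _ x). Qed.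

Lemma resolvent_equation (lambda : C) : lambda <> 0 -> Re (1 - / lambda) <> 0 ->
  exists K, 0 < K /\ forall g : C_l, exists f : C_l,
    scalar_minus lambda cesaro f = g /\ sup_norm f <= K * sup_norm g.
Proof.
intros Hl Ha.
set (mu := (/ lambda)%C) in *; set (a := (1 - mu)%C) in *.
assert (Hra : 0 < Rabs (Re a)) by now apply Rabs_pos_lt.
assert (Hmu : 0 < Cmod mu).
{ apply Cmod_gt_0; intros E.
  assert (E' : (lambda * mu = 1)%C) by (unfold mu; field; exact Hl).
  rewrite E, Cmult_0_r in E'; apply RtoC_inj in E'; lra. }
(* From [f = mu (g + h)] and the bound of [h] by [|mu| |g| / |Re a|]. *)
exists (Cmod mu * (1 + Cmod mu / Rabs (Re a))); split.
{ apply Rmult_lt_0_compat; [exact Hmu |].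
  pose proof (Rdiv_lt_0_compat _ _ Hmu Hra); lra. }
intros g.
destruct (linear_ode_solution a (fun u => mu * extend g (exp u))%C
            (Cmod mu * sup_norm g) Ha) as [y [Hy [Hd Hb]]].
- apply continuous_with_limits_scal, extend_exp_limits.
- intros t; rewrite Cmod_mult; apply Rmult_le_compat_l; [lra | apply Cmod_extend_le].
- destruct (C_l_of_log y Hy) as [h Hh].
  set (f := C_l_scal mu (C_l_plus g h)).
  assert (Hf : cesaro f = h).
  { apply cesaro_eq_of_ode; intros u.
    apply cderiv_ext with (1 := fun s => eq_sym (Hh s)).
    refine (cderiv_eq _ _ _ _ (Hd u) _).
    change (extend f (exp u)) with (mu * (extend g (exp u) + extend h (exp u)))%C.
    (* Since [f = mu (g + h)], the right-hand side [- h + f] equals [- a h + mu g]. *)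
    rewrite Hh; unfold a; ring. }
  exists f; split.
  + apply C_l_eq; intros x; rewrite scalar_minus_cesaroE, Hf; simpl.
    unfold mu; field; exact Hl.
  + apply sup_norm_exp_le; intros u.
    change (extend f (exp u)) with (mu * (extend g (exp u) + extend h (exp u)))%C.
    rewrite Hh, Cmod_mult, Rmult_assoc; apply Rmult_le_compat_l; [lra |].
    eapply Rle_trans; [apply Cmod_triangle |].
    pose proof (Cmod_extend_le g (exp u)); specialize (Hb u).
    replace ((1 + Cmod mu / Rabs (Re a)) * sup_norm g) with
      (sup_norm g + Cmod mu * sup_norm g / Rabs (Re a)) by (field; lra).
    lra.
Qed.

(** * Injectivity away from the eigenvalue 1 *)

(** For [lambda <> 0] the function [phi = f o exp] satisfies [phi' = - a phi], so
    [|phi u| = exp(- Re a (u - w)) |phi w|] for every [w]. If [Re a < 0], let [w] tend to +oo and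
    use that [phi] is bounded. If [Re a >= 0], let [w] tend to -oo, where [phi] tends to [f 0]; this
    is 0 because [C f] and [f] agree at 0 and [lambda <> 1]. *)
Lemma cesaro_eigenvector_zero (lambda : C) (f : C_l) : lambda <> RtoC 1 ->
  (forall x, (lambda * f x = cesaro f x)%C) -> forall x, f x = 0.
Proof.
intros Hl1 Heig.
assert (Hext : forall t, (extend (cesaro f) t = lambda * extend f t)%C)
  by (intros t; symmetry; apply Heig).
pose (phi := fun s => extend f (exp s)).
assert (Hode : forall u, cderiv (fun s => lambda * phi s)%C u (- (1) * (lambda * phi u) + phi u)%C).
{ intros u; apply cderiv_ext with (1 := fun s => Hext (exp s)).
  unfold phi; rewrite <- Hext; apply cesaro_ode. }
assert (Hphi : forall u, phi u = 0).
{ destruct (Ceq_dec lambda 0) as [-> | Hl0].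
  (* For [lambda = 0] the differentiated function is identically zero, and the equation reduces to
     [phi u = 0]. *)
  - intros u.
    assert (K : cderiv (fun s => 0 * phi s)%C u 0).
    { apply cderiv_ext with (y := fun _ => RtoC 0); [intros; ring | apply cderiv_const]. }
    rewrite (cderiv_unique _ _ _ _ K (Hode u)); ring.
  - set (a := (1 - / lambda)%C).
    assert (Hd : forall u, cderiv phi u (- a * phi u)%C).
    { intros u; apply cderiv_ext with (y := fun s => (/ lambda * (lambda * phi s))%C).
        intros s; field; exact Hl0.
      refine (cderiv_eq _ _ _ _ (cderiv_scal (/ lambda) _ _ _ (Hode u)) _).
      unfold a; field; exact Hl0. }
    pose proof (linear_ode_homogeneous a phi Hd) as Hexp.
    intros u; apply Cmod_eq_0, Rle_antisym; [| apply Cmod_ge_0].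
    apply le_epsilon; intros eps He; rewrite Rplus_0_l.
    destruct (Rlt_le_dec (Re a) 0) as [Hneg | Hpos].
    + set (K := sup_norm f + 1).
      assert (HK : 0 < K).
      { pose proof (Cmod_ge_0 (extend f 0)); pose proof (Cmod_extend_le f 0); unfold K; lra. }
      destruct (exp_small_m_infty (- Re a) (eps / K) ltac:(lra)) as [A HA].
        now apply Rdiv_lt_0_compat.
      (* Then [u - w = A - 1], just inside the range where the exponential is below [eps / K]. *)
      set (w := u - A + 1).
      rewrite (Hexp w u).
      apply Rle_trans with (eps / K * K); [| apply Req_le; field; lra].
      apply Rmult_le_compat.
      * apply Rlt_le, exp_pos.
      * apply Cmod_ge_0.
      * apply Rlt_le, HA; unfold w; lra.
      * pose proof (Cmod_extend_le f (exp w)); unfold phi, K; lra.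
    (* This case contains the circle, [Re a = 0]: there [|phi|] is constant and only its limit 0 at
       -oo makes it vanish. *)
    + assert (Hf0 : extend f 0 = 0).
      { assert (E : (lambda * extend f 0 = extend f 0)%C).
        { rewrite <- Hext; unfold extend; simpl; unfold cesaro_fun; simpl.
          destruct Req_EM_T as [_ | E].
            f_equal; apply nonnegreal_eq; simpl; symmetry; apply Rmax_right, Rle_refl.
          exfalso; apply E, Rmax_right, Rle_refl. }
        assert (E' : ((lambda - 1) * extend f 0 = 0)%C).
        { transitivity (lambda * extend f 0 - extend f 0)%C; [ring | rewrite E; ring]. }
        assert (Hl : (lambda - 1 <> 0)%C).
        { intros H; apply Hl1; replace lambda with ((lambda - 1) + 1)%C by ring.
          rewrite H; ring. }
        replace (extend f 0) with (/ (lambda - 1) * ((lambda - 1) * extend f 0))%C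
          by (field; exact Hl).
        rewrite E'; ring. }
      assert (Hlim : filterlim (fun v => extend f (exp v)) (Rbar_locally m_infty)
                       (locally (extend f 0))).
      { exact (filterlim_comp _ _ _ exp (extend f) _ _ _ is_lim_exp_m (extend_continuous f 0)). }
      rewrite filterlim_C in Hlim by apply Rbar_locally_filter.
      destruct (Hlim (mkposreal eps He)) as [A HA]; simpl in HA.
      set (w := Rmin A u - 1).
      assert (Hw : w < A /\ w <= u).
      { unfold w; pose proof (Rmin_l A u); pose proof (Rmin_r A u); lra. }
      specialize (HA w (proj1 Hw)); rewrite Hf0 in HA.
      replace (extend f (exp w) - 0)%C with (phi w) in HA by (unfold phi; ring).
      rewrite (Hexp w u).
      apply Rle_trans with (1 * Cmod (phi w)); [| lra].
      apply Rmult_le_compat_r; [apply Cmod_ge_0 |].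
      assert (Hexp0 : - Re a * (u - w) <= 0).
      { pose proof (Rmult_le_pos _ (u - w) Hpos ltac:(lra)); lra. }
      rewrite <- exp_0; destruct Hexp0 as [Hlt | ->]; [| lra].
      apply Rlt_le, exp_increasing, Hlt. }
intros x; replace f with C_l_zero; [reflexivity |].
apply C_l_eq_exp; intros u; symmetry; apply Hphi.
Qed.

Lemma scalar_minus_cesaro_plus (lambda : C) (f g : C_l) :
  scalar_minus lambda cesaro (plus f g) =
  plus (scalar_minus lambda cesaro f) (scalar_minus lambda cesaro g).
Proof.
unfold scalar_minus; rewrite (linear_plus _ (op_linear _ cesaro)).
apply C_l_eq; intros x; simpl; ring.
Qed.

Lemma scalar_minus_cesaro_scal (lambda c : C) (f : C_l) :
  scalar_minus lambda cesaro (scal c f) = scal c (scalar_minus lambda cesaro f).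
Proof.
unfold scalar_minus; rewrite (linear_scal _ (op_linear _ cesaro)).
apply C_l_eq; intros x; simpl; ring.
Qed.

Lemma scalar_minus_cesaro_injective (lambda : C) (f g : C_l) : lambda <> RtoC 1 ->
  scalar_minus lambda cesaro f = scalar_minus lambda cesaro g -> f = g.
Proof.
intros Hl H.
set (d := plus f (scal (- (1))%C g) : C_l).
assert (Hd : scalar_minus lambda cesaro d = C_l_zero).
{ unfold d; rewrite scalar_minus_cesaro_plus, scalar_minus_cesaro_scal, H.
  apply C_l_eq; intros x; simpl; ring. }
assert (K : forall x, d x = 0).
{ apply (cesaro_eigenvector_zero lambda d Hl); intros x.
  pose proof (scalar_minus_cesaroE lambda d x) as E; rewrite Hd in E; simpl in E.
  replace (lambda * d x)%C with ((lambda * d x - cesaro d x) + cesaro d x)%C by ring.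
  simpl; rewrite <- E; ring. }
apply C_l_eq; intros x.
replace (f x) with (d x + g x)%C by (simpl; ring).
rewrite K; ring.
Qed.

(** * The resolvent as a bounded operator *)

(** A solution is chosen for each right-hand side; injectivity makes the choice linear and a left
    inverse, and the estimate makes it bounded. *)
Lemma resolvent_exists (lambda : C) : lambda <> 0 -> Re (1 - / lambda) <> 0 ->
  invertible_op (scalar_minus lambda cesaro).
Proof.
intros Hl Ha.
destruct (resolvent_equation lambda Hl Ha) as [K [HK Hsol]].
(* The value [lambda = 1] gives [a = 0], which [Ha] excludes. *)
assert (Hl1 : lambda <> RtoC 1).
{ intros ->; apply Ha; replace (1 - / 1)%C with (RtoC 0) by (field; exact Hl).
  reflexivity. }
pose proof (fun f g => scalar_minus_cesaro_injective lambda f g Hl1) as Hinj.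
pose (S := fun g : C_l => proj1_sig (constructive_indefinite_description _ (Hsol g))).
assert (HS : forall g, scalar_minus lambda cesaro (S g) = g /\ sup_norm (S g) <= K * sup_norm g).
{ intros g; unfold S; now destruct constructive_indefinite_description. }
clearbody S.
assert (Slin : is_linear (U := C_l_NormedModule) (V := C_l_NormedModule) S).
{ split.
  - intros f g; apply Hinj; rewrite scalar_minus_cesaro_plus.
    now rewrite !(proj1 (HS _)).
  - intros c f; apply Hinj; rewrite scalar_minus_cesaro_scal.
    now rewrite !(proj1 (HS _)).
  - exists K; split; [exact HK |]; intros g; apply HS. }
exists (Build_bounded_operator C_l_CompleteNormedModule S Slin); split; intros g; simpl.
- apply Hinj, HS.
- apply HS.
Qed.

(** * Approximate eigenvectors *)

Lemma quadratic_decay_limits (phi : R -> C) (B c : R) : 0 <= B -> 0 < c ->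
  (forall t, continuous phi t) -> (forall t, Cmod (phi t) <= B / (1 + c * t ^ 2)) ->
  continuous_with_limits phi.
Proof.
intros HB Hc Hcont Hb.
assert (H : forall eps : posreal, exists A, forall t, A < Rabs t -> Cmod (phi t - 0) < eps).
{ intros eps; pose proof (cond_pos eps) as He.
  (* The summand 1 gives [|t| >= 1], hence [t^2 >= |t| > B / (eps c)]. *)
  exists (1 + B / (eps * c)); intros t Ht.
  replace (phi t - 0)%C with (phi t) by ring.
  apply Rle_lt_trans with (1 := Hb t).
  assert (H0 : 0 < eps * c) by now apply Rmult_lt_0_compat.
  assert (HBc : 0 <= B / (eps * c)) by now apply Rdiv_le_0_compat.
  assert (Ht2 : B / (eps * c) < t ^ 2).
  { rewrite <- pow2_abs; simpl; rewrite Rmult_1_r.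
    apply Rlt_le_trans with (Rabs t * 1); [lra | apply Rmult_le_compat_l; lra]. }
  apply Rmult_lt_compat_l with (r := eps * c) in Ht2; [| exact H0].
  replace (eps * c * (B / (eps * c))) with B in Ht2 by (field; lra).
  pose proof (Rmult_le_pos _ _ (Rlt_le _ _ Hc) (pow2_ge_0 t)).
  apply Rmult_lt_reg_r with (1 + c * t ^ 2); [lra |].
  unfold Rdiv; rewrite Rmult_assoc, Rinv_l by lra; lra. }
split; [exact Hcont | split]; exists (RtoC 0);
  rewrite filterlim_C by apply Rbar_locally_filter; intros eps;
  destruct (H eps) as [A HA].
- exists (- Rabs A); intros t Ht; apply HA.
  pose proof (Rle_abs A); pose proof (Rle_abs (- t)); rewrite Rabs_Ropp in *; lra.
- exists A; intros t Ht; apply HA.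
  pose proof (Rle_abs t); lra.
Qed.

(** With [k = 1 / (1 + eps^2 t^2)] and [y = exp(i s t) k], one has [y' = i s y + w], where
    [w = exp(i s t) k'] has modulus at most [eps]. Then [f = y + y' = (1 + i s) y + w] has
    [C f = y], and the defect is exactly [w]. The value of [f] at 1 bounds its norm from below, as
    [k(0) = 1] and [k'(0) = 0]. *)
Lemma cesaro_approximate_eigenvector (s eps : R) : 0 < eps ->
  exists f : C_l, extend f 1 = (1, s) /\ sup_norm (cesaro f) <= 1 /\
    forall x, Cmod (f x - (1, s) * cesaro f x) <= eps.
Proof.
intros He.
pose (c := eps ^ 2).
assert (Hc : 0 < c) by (apply pow_lt, He).
assert (Hden : forall t, 1 <= 1 + c * t ^ 2).
{ intros t; pose proof (Rmult_le_pos _ _ (Rlt_le _ _ Hc) (pow2_ge_0 t)); lra. }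
pose (is := ((0, s) : C)).
pose (k := fun t => / (1 + c * t ^ 2)).
pose (k' := fun t => - (2 * c * t) * (k t * k t)).
assert (Hk : forall t, is_derive k t (k' t)).
{ intros t; specialize (Hden t); unfold k', k; auto_derive; [lra | field; lra]. }
assert (Hk0 : forall t, 0 < k t <= 1).
{ intros t; specialize (Hden t); unfold k; split.
  - apply Rinv_0_lt_compat; lra.
  - rewrite <- Rinv_1; apply Rinv_le_contravar; lra. }
assert (Hk' : forall t, Rabs (k' t) <= eps * k t).
{ intros t; unfold k'; destruct (Hk0 t) as [H1 H2].
  rewrite Rabs_mult, (Rabs_pos_eq (k t * k t)) by (apply Rmult_le_pos; lra).
  rewrite <- Rmult_assoc; apply Rmult_le_compat_r; [lra |].
  apply Rle_trans with (eps * (1 + c * t ^ 2) * k t).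
  - apply Rmult_le_compat_r; [lra |].
    (* Expanding the two squares gives [2 eps^2 |t| <= eps (1 + eps^2 t^2)]. *)
    pose proof (Rmult_le_pos _ _ (Rlt_le _ _ He) (pow2_ge_0 (eps * t - 1))).
    pose proof (Rmult_le_pos _ _ (Rlt_le _ _ He) (pow2_ge_0 (eps * t + 1))).
    unfold c; rewrite Rabs_Ropp; apply Rabs_le; split; lra.
  - unfold k; specialize (Hden t); rewrite Rmult_assoc, Rinv_r by lra; lra. }
pose (y := fun t => (cexp is t * RtoC (k t))%C).
pose (w := fun t => (cexp is t * RtoC (k' t))%C).
assert (Hcm : forall t, Cmod (cexp is t) = 1).
{ intros t; rewrite Cmod_cexp; simpl; rewrite Rmult_0_l; apply exp_0. }
assert (Hy : forall t, cderiv y t (is * y t + w t)%C).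
{ intros t; refine (cderiv_eq _ _ _ _ (cderiv_mult _ _ _ _ _ (cderiv_cexp is t)
    (cderiv_real _ _ _ (Hk t))) _).
  unfold y, w; ring. }
assert (Hym : forall t, Cmod (y t) = k t).
{ intros t; unfold y; rewrite Cmod_mult, Hcm, Cmod_R, Rabs_pos_eq; [ring |].
  apply Rlt_le, Hk0. }
assert (Hwm : forall t, Cmod (w t) <= eps * k t).
{ intros t; unfold w; rewrite Cmod_mult, Hcm, Cmod_R, Rmult_1_l; apply Hk'. }
destruct (C_l_of_log y) as [h Hh].
{ apply (quadratic_decay_limits y 1 c); [lra | exact Hc | |].
  - intros t; apply cderiv_continuous with (1 := Hy t).
  - intros t; rewrite Hym; apply Req_le; unfold k, Rdiv; ring. }
destruct (C_l_of_log w) as [q Hq].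
{ apply (quadratic_decay_limits w eps c); [lra | exact Hc | |].
  - intros t; apply continuous_Cmult.
    + apply cderiv_continuous with (1 := cderiv_cexp is t).
    + assert (E : ex_derive k' t).
      { unfold k', k; specialize (Hden t); auto_derive; repeat split; lra. }
      destruct E as [l E]; apply cderiv_continuous with (1 := cderiv_real _ _ _ E).
  - intros t; apply Hwm. }
pose (f := C_l_plus (C_l_scal (1, s) h) q).
assert (Hf : cesaro f = h).
{ apply cesaro_eq_of_ode; intros u.
  apply cderiv_ext with (1 := fun s => eq_sym (Hh s)).
  refine (cderiv_eq _ _ _ _ (Hy u) _).
  change (extend f (exp u)) with ((1, s) * extend h (exp u) + extend q (exp u))%C.
  rewrite Hh, Hq; replace (1, s) with (1 + is)%C; [ring |].
  apply injective_projections; simpl; ring. }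
exists f; split; [| split].
- rewrite <- exp_0.
  change (extend f (exp 0)) with ((1, s) * extend h (exp 0) + extend q (exp 0))%C.
  rewrite Hh, Hq; unfold y, w.
  replace (k' 0) with 0 by (unfold k'; ring).
  replace (k 0) with 1 by (unfold k; field).
  rewrite cexp_0, exp_0; ring.
- rewrite Hf; apply sup_norm_exp_le; intros u; rewrite Hh, Hym; apply Hk0.
- intros x; rewrite Hf; simpl.
  replace ((1, s) * h x + q x - (1, s) * h x)%C with (q x) by ring.
  apply Rle_trans with (1 := sup_norm_ge q x), sup_norm_exp_le; intros u; rewrite Hq.
  apply Rle_trans with (1 := Hwm u); destruct (Hk0 u).
  rewrite <- (Rmult_1_r eps) at 2; apply Rmult_le_compat_l; lra.
Qed.

(** * The circle lies in the spectrum *)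

(** The circle is [x^2 + y^2 = x]; away from 0, inversion turns it into the line
    [Re (1 / lambda) = 1]. *)
Lemma circle_iff_Re_inv (lambda : C) :
  Cmod (lambda - RtoC (1 / 2)) = 1 / 2 <-> lambda = 0 \/ Re (1 - / lambda) = 0.
Proof.
destruct lambda as [x y].
assert (E : Cmod ((x, y) - RtoC (1 / 2)) = 1 / 2 <-> x ^ 2 + y ^ 2 = x).
{ unfold Cmod; simpl fst; simpl snd.
  replace ((x + - (1 / 2)) ^ 2 + (y + - 0) ^ 2) with (x ^ 2 + y ^ 2 - x + (1 / 2) ^ 2) by field.
  split; intros H.
  - apply (f_equal (fun r => r ^ 2)) in H; rewrite pow2_sqrt in H; [lra |].
    replace (x ^ 2 + y ^ 2 - x + (1 / 2) ^ 2) with ((x - 1 / 2) ^ 2 + y ^ 2) by field.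
    apply Rplus_le_le_0_compat; apply pow2_ge_0.
  - rewrite H; replace (x - x + (1 / 2) ^ 2) with ((1 / 2) ^ 2) by ring.
    apply sqrt_pow2; lra. }
rewrite E; clear E.
destruct (Ceq_dec (x, y) 0) as [H0 | H0].
{ injection H0; intros -> ->; split; [left; reflexivity | intros _; ring]. }
assert (Hn : x ^ 2 + y ^ 2 <> 0).
{ intros H; apply H0; pose proof (pow2_ge_0 x); pose proof (pow2_ge_0 y).
  apply injective_projections; simpl; apply Rsqr_0_uniq; rewrite Rsqr_pow2; lra. }
assert (E : Re (1 - / (x, y)) = 1 - x / (x ^ 2 + y ^ 2)) by reflexivity.
rewrite E; split; intros H.
- right; rewrite H; field; rewrite <- H; exact Hn.
- destruct H as [H | H]; [contradiction |].
  assert (E' : x / (x ^ 2 + y ^ 2) * (x ^ 2 + y ^ 2) = x) by (field; exact Hn).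
  replace (x / (x ^ 2 + y ^ 2)) with 1 in E' by lra; lra.
Qed.

(** A bounded inverse forces the operator to be bounded below; the approximate eigenvectors
    contradict this on the circle. *)
Lemma cesaro_inverse_lower_bound (lambda : C) :
  invertible_op (scalar_minus lambda cesaro) ->
  exists K, 0 < K /\
    forall f : C_l, sup_norm f <= K * sup_norm (scalar_minus lambda cesaro f).
Proof.
intros [S [HS _]].
destruct (linear_norm _ (op_linear _ S)) as [K [HK Hb]].
exists K; split; [exact HK |]; intros f.
rewrite <- (HS f) at 1; apply Hb.
Qed.

Lemma cesaro_spectrum_circle (lambda : C) :
  lambda = 0 \/ Re (1 - / lambda) = 0 -> spectrum cesaro lambda.
Proof.
intros Hl Hinv.
destruct (cesaro_inverse_lower_bound lambda Hinv) as [K [HK Hb]].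
destruct (Ceq_dec lambda 0) as [-> | Hl0].
(* At [lambda = 0] the frequency [K + 1] gives [|f| >= K + 1] while [|C f| <= 1]. *)
- destruct (cesaro_approximate_eigenvector (K + 1) 1 Rlt_0_1) as [f [Hf1 [HCf _]]].
  assert (Hs : sup_norm (scalar_minus 0 cesaro f) <= 1).
  { apply sup_norm_le; intros x; rewrite scalar_minus_cesaroE.
    replace (0 * f x - cesaro f x)%C with (- cesaro f x)%C by ring.
    rewrite Cmod_opp; exact (Rle_trans _ _ _ (sup_norm_ge (cesaro f) x) HCf). }
  pose proof (Cmod_extend_le f 1) as H; rewrite Hf1 in H.
  pose proof (Rle_trans _ _ _ (Rmax_r _ _) (Rmax_Cmod (1, K + 1))) as H1; simpl in H1.
  pose proof (Rle_abs (K + 1)).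
  specialize (Hb f); pose proof (Rmult_le_compat_l K _ _ (Rlt_le _ _ HK) Hs); lra.
- destruct Hl as [Hl | Hl]; [contradiction |].
  assert (Hlm : 0 < Cmod lambda) by now apply Cmod_gt_0.
  assert (Hinvl : (/ lambda)%C = (1, Im (/ lambda))).
  { apply injective_projections; [| reflexivity].
    change (Re (1 - / lambda)) with (1 + - Re (/ lambda)) in Hl.
    change (Re (/ lambda) = 1); lra. }
  (* Makes [K] times the defect bound [|lambda| eps] equal to [1 / 2], whereas [|f| >= 1]. *)
  pose (eps := / (2 * K * Cmod lambda)).
  assert (Hp : 0 < 2 * K * Cmod lambda) by (apply Rmult_lt_0_compat; lra).
  destruct (cesaro_approximate_eigenvector (Im (/ lambda)) eps) as [f [Hf1 [_ Hf]]].
    now apply Rinv_0_lt_compat.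
  rewrite <- Hinvl in Hf.
  assert (Hs : sup_norm (scalar_minus lambda cesaro f) <= Cmod lambda * eps).
  { apply sup_norm_le; intros x; rewrite scalar_minus_cesaroE.
    replace (lambda * f x - cesaro f x)%C with (lambda * (f x - / lambda * cesaro f x))%C
      by (field; exact Hl0).
    rewrite Cmod_mult; apply Rmult_le_compat_l; [lra | apply Hf]. }
  pose proof (Cmod_extend_le f 1) as H; rewrite Hf1 in H.
  pose proof (Rle_trans _ _ _ (Rmax_l _ _) (Rmax_Cmod (1, Im (/ lambda)))) as H1.
  simpl fst in H1; rewrite Rabs_R1 in H1.
  specialize (Hb f); pose proof (Rmult_le_compat_l K _ _ (Rlt_le _ _ HK) Hs) as H2.
  replace (K * (Cmod lambda * eps)) with (1 / 2) in H2 by (unfold eps; field; lra).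
  lra.
Qed.


(** * The eigenvalue 1 and the two spectra *)

(** Constant functions are fixed by the Cesàro operator. *)
Lemma cesaro_eigenvalue_1 : point_spectrum cesaro (RtoC 1).
Proof.
intros Hinj.
destruct (C_l_of_log (fun _ => RtoC 1)) as [f Hf].
{ split; [| split].
  - intros t; apply continuous_const.
  - exists (RtoC 1); apply filterlim_const.
  - exists (RtoC 1); apply filterlim_const. }
assert (HC : cesaro f = f).
{ apply cesaro_eq_of_ode; intros u.
  apply cderiv_ext with (1 := fun s => eq_sym (Hf s)).
  refine (cderiv_eq _ _ _ _ (cderiv_const 1 u) _); ring. }
assert (E : f = C_l_zero).
{ apply Hinj, C_l_eq; intros x; rewrite !scalar_minus_cesaroE, HC.
  rewrite (cesaro_eq_of_ode C_l_zero C_l_zero); [simpl; ring |].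
  intros u; refine (cderiv_eq _ _ _ _ (cderiv_const 0 u) _).
  change (extend C_l_zero (exp u)) with (RtoC 0); ring. }
specialize (Hf 0); rewrite E in Hf; apply RtoC_inj in Hf; lra.
Qed.

Theorem proposition2p8 :
  (forall lambda : C,
     spectrum cesaro lambda <-> Cmod (lambda - RtoC (1 / 2)) = 1 / 2) /\
  (forall lambda : C,
     point_spectrum cesaro lambda <-> lambda = RtoC 1).
Proof.
split; intros lambda.
- rewrite circle_iff_Re_inv; split; [| apply cesaro_spectrum_circle].
  intros Hs; destruct (Ceq_dec lambda 0) as [| Hl0]; [now left | right].
  destruct (Req_dec (Re (1 - / lambda)) 0) as [| Ha]; [assumption |].
  destruct Hs; now apply resolvent_exists.
- split.
  + intros Hp; destruct (Ceq_dec lambda (RtoC 1)) as [| Hl]; [assumption |].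
    destruct Hp; intros f g; now apply scalar_minus_cesaro_injective.
  + intros ->; exact cesaro_eigenvalue_1.
Qed.
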